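(* Let $d\ge 1$, $k\in\{0,1,\ldots,d\}$, and consider a great hypersphere tessellation of $\mathbb{S}^d$ with non-degenerate directional distribution $\kappa$ and intensity $n\ge d-k$. For $\ell\in\{0,1,\ldots,k-1\}$ the expected number of $\ell$-faces of the typical spherical $k$-face is given by $$\mathbf{E}f_\ell(Z_{n,d}^{(k)})=\frac{2^{k-\ell}\binom{n-d+k}{k-\ell}\,C(n-d+\ell,\ell)}{C(n-d+k,k)}.$$
   Context: $\mathbb{S}^d$ is the unit sphere of $\mathbb{R}^{d+1}$; great hyperspheres are intersections of $\mathbb{S}^d$ with $d$-dimensional linear subspaces. A spherical polytope is $P=C\cap\mathbb{S}^d$ with $C\ne\{0\}$ a polyhedral cone in $\mathbb{R}^{d+1}$; its $\ell$-dimensional spherical faces ($\ell$-faces) are the intersections of $\mathbb{S}^d$ with the $(\ell+1)$-dimensional faces of $C$; $\mathcal{F}_\ell(P)$ is the set of these and $f_\ell(P)=|\mathcal{F}_\ell(P)|$. Tessellation: let $\kappa^\circ$ be an even Borel probability measure on $\mathbb{S}^d$ with $\kappa^\circ(S)=0$ for every great hypersphere $S$, and let $\kappa$ be its image under $u\mapsto u^\perp\cap\mathbb{S}^d$; such a $\kappa$ is what is meant here by a non-degenerate directional distribution. For $n\in\mathbb{N}$ let $S_1,\ldots,S_n$ be independent random great hyperspheres with distribution $\kappa$. The great hypersphere tessellation $T_{n,d}$ of intensity $n$ and directional distribution $\kappa$ is the random finite collection of spherical polytopes (cells) into which $S_1,\ldots,S_n$ partition $\mathbb{S}^d$, that is,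 the closures of the connected components of $\mathbb{S}^d\setminus(S_1\cup\cdots\cup S_n)$. Put $\mathcal{F}_k(T_{n,d})=\bigcup_{P\in T_{n,d}}\mathcal{F}_k(P)$. The typical spherical $k$-face $Z_{n,d}^{(k)}$ is, given $T_{n,d}$, chosen uniformly at random from the almost surely finite set $\mathcal{F}_k(T_{n,d})$. Constants: $C(m,j)=2\sum_{r=0}^{j}\binom{m-1}{r}$ (almost surely the number of cells into which $m$ independent great hyperspheres with a non-degenerate directional distribution divide $\mathbb{S}^j$).
   Formalization: C(0,j) is taken to be 1 (the number of cells cut by zero great hyperspheres) instead of the displayed sum with upper index -1, with which the formula fails at n = d-ℓ (for example d = k = n = 1, ℓ = 0, where the true value is 1 and not 2). *)

(* Defs.v *)
From HB Require Import structures.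
From mathcomp Require Import all_boot all_order all_algebra.
From mathcomp Require Import finmap.
From mathcomp Require Import all_classical all_reals all_analysis.
Import Order.TTheory GRing.Theory Num.Theory numFieldNormedType.Exports.

Set Implicit Arguments.
Unset Strict Implicit.
Unset Printing Implicit Defensive.

Local Open Scope classical_set_scope.
Local Open Scope ring_scope.

(* The library norm on ['rV[R]_d.+1] is the max norm, so the Euclidean sphere
   is defined through the dot product.  The topology is the usual one. *)
Definition dot (R : realType) (d : nat) (x y : 'rV[R]_d.+1) : R :=
  \sum_(i < d.+1) x ord0 i * y ord0 i.

Definition sphere (R : realType) (d : nat) : set 'rV[R]_d.+1 :=
  [set x | dot x x = 1].

Arguments sphere : clear implicits.

Definition is_great_hypersphere (R : realType) (d : nat)
    (A : set 'rV[R]_d.+1) : Prop :=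
  exists2 L : {vspace 'rV[R]_d.+1},
    \dim L = d & A = sphere R d `&` [set x | x \in L].

Definition perp (R : realType) (d : nat) (u : 'rV[R]_d.+1) :
    set 'rV[R]_d.+1 :=
  sphere R d `&` [set x | dot u x = 0].

(** * Polyhedral cones and spherical polytopes *)

Definition polyhedral_cone (R : realType) (d : nat)
    (C : set 'rV[R]_d.+1) : Prop :=
  exists (m : nat) (a : 'I_m -> 'rV[R]_d.+1),
    C = [set x | forall i, dot (a i) x <= 0].

(* The choice [a = 0] makes [C] a face of itself. *)
Definition cone_face (R : realType) (d : nat) (C G : set 'rV[R]_d.+1) : Prop :=
  exists2 a : 'rV[R]_d.+1,
    forall x, C x -> dot a x <= 0 & G = C `&` [set x | dot a x = 0].

Definition is_linear_hull (R : realType) (d : nat) (G : set 'rV[R]_d.+1)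
    (L : {vspace 'rV[R]_d.+1}) : Prop :=
  (forall x, G x -> x \in L) /\
  (forall L' : {vspace 'rV[R]_d.+1},
     (forall x, G x -> x \in L') -> (L <= L')%VS).

Definition cone_has_dim (R : realType) (d : nat) (G : set 'rV[R]_d.+1)
    (m : nat) : Prop :=
  exists2 L : {vspace 'rV[R]_d.+1}, is_linear_hull G L & \dim L = m.

(* [sph_faces l P] is the set of [l]-faces of [P]; the cone [C] is determined
   by [P] as the set of nonnegative multiples of points of [P], and the set is
   empty when [P] is not a spherical polytope. *)
Definition sph_faces (R : realType) (d l : nat) (P : set 'rV[R]_d.+1) :
    set (set 'rV[R]_d.+1) :=
  [set Q | exists C G : set 'rV[R]_d.+1,
     [/\ polyhedral_cone C, C <> [set 0] & P = C `&` sphere R d] /\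
     [/\ cone_face C G, cone_has_dim G l.+1 & Q = G `&` sphere R d]].

Definition face_number (R : realType) (d l : nat) (P : set 'rV[R]_d.+1) : nat :=
  #|` fset_set (sph_faces l P)|%fset.

(** * Great hypersphere tessellations *)

Definition tess_cells (R : realType) (d n : nat)
    (S : 'I_n -> set 'rV[R]_d.+1) : set (set 'rV[R]_d.+1) :=
  let A := sphere R d `\` \bigcup_i S i in
  [set closure (connected_component A x) | x in A].

Definition tess_faces (R : realType) (d n k : nat)
    (S : 'I_n -> set 'rV[R]_d.+1) : set (set 'rV[R]_d.+1) :=
  \bigcup_(P in tess_cells S) sph_faces k P.

(** * Directional distributions *)

Definition borelE (R : realType) (d : nat) :=
  g_sigma_algebraType (@open 'rV[R]_d.+1).

(* Borel probability measures on the sphere are represented as Borel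
   probability measures on the ambient space carried by the sphere. *)
Definition even_sphere_distribution (R : realType) (d : nat)
    (kappa0 : probability (borelE R d) R) : Prop :=
  kappa0 (sphere R d) = 1%E /\
  forall A : set (borelE R d), measurable A ->
    kappa0 [set u : 'rV[R]_d.+1 | A (- u)] = kappa0 A.

Definition nondegenerate_distribution (R : realType) (d : nat)
    (kappa0 : probability (borelE R d) R) : Prop :=
  forall A : set 'rV[R]_d.+1, is_great_hypersphere A -> kappa0 A = 0%E.

(* The measurable space in which random great hyperspheres take their values:
   subsets of the ambient space, with the largest sigma-algebra making
   [perp] measurable.  On the set of great hyperspheres (identified by [perp]
   with the quotient of the sphere by the antipodal map, a compact metrizable
   space) it induces the Borel sigma-algebra. *)
Definition hypersphere_space (R : realType) (d : nat) :=
  g_sigma_algebraType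
    (image_set_system [set: borelE R d]
       (@perp R d : borelE R d -> set 'rV[R]_d.+1) measurable).

Definition directional_distribution (R : realType) (d : nat)
    (kappa0 : probability (borelE R d) R) :
    set (hypersphere_space R d) -> \bar R :=
  pushforward kappa0 (@perp R d : borelE R d -> hypersphere_space R d).

Definition mutually_independent (disp disp' : measure_display)
    (Omega : measurableType disp) (E : measurableType disp') (R : realType)
    (P : probability Omega R) (n : nat) (X : 'I_n -> {RV P >-> E}) : Prop :=
  forall B : 'I_n -> set E, (forall i, measurable (B i)) ->
    P (\bigcap_i (X i @^-1` B i)) = (\prod_(i < n) P (X i @^-1` B i))%E.

(* [S_1, ..., S_n] are independent great hyperspheres with distribution
   [directional_distribution kappa0]. *)
Definition iid_great_hyperspheres (disp : measure_display)
    (Omega : measurableType disp) (R : realType) (P : probability Omega R)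
    (d n : nat) (kappa0 : probability (borelE R d) R)
    (S : 'I_n -> {RV P >-> hypersphere_space R d}) : Prop :=
  mutually_independent S /\
  forall i (B : set (hypersphere_space R d)), measurable B ->
    distribution P (S i) B = directional_distribution kappa0 B.

(** * The typical face *)

(* The expectation of [g] under the uniform distribution on a finite set. *)
Definition uniform_mean (R : realType) (T : choiceType) (A : set T)
    (g : T -> R) : R :=
  (\sum_(F \in A) g F) / (#|` fset_set A|%fset)%:R.

(* [E g(Z)] for the typical spherical [k]-face [Z]: first the tessellation is
   drawn, and then, given the tessellation, [Z] is drawn uniformly from its
   (almost surely finite and nonempty) set of [k]-faces. *)
Definition typical_face_expectation (disp : measure_display)
    (Omega : measurableType disp) (R : realType) (P : probability Omega R)
    (d n k : nat) (S : 'I_n -> {RV P >-> hypersphere_space R d})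
    (g : set 'rV[R]_d.+1 -> R) : \bar R :=
  'E_P[fun w : Omega =>
         uniform_mean (tess_faces k (fun i => S i w : set 'rV[R]_d.+1)) g]%E.

(* The number of cells into which [m] great hyperspheres in general position
   divide the [j]-dimensional sphere.  The binomial formula is the one for
   [m >= 1].  For [m = 0] the sphere is not divided and is the only cell; this
   case occurs in the theorem at [n = d - l], where all the hyperspheres
   intersect in one great [l]-subsphere, which is an [l]-face (for [l = 0] it
   is a pair of antipodal points, cut out by a 1-dimensional face which is a
   line), and at [n = d - k]. *)
Definition cell_number (m j : nat) : nat :=
  if m == 0%N then 1%N else (2 * \sum_(r < j.+1) 'C(m.-1, r))%N.

(* Main.v *)
(* Almost surely the normal vectors are in general position, and then the
   quantity whose mean is taken is deterministic, so that the expectation is a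
   ratio of two face counts.

   For vectors [u_i] in general position, each face of the tessellation is the
   set of points of the sphere whose sign vector [(sgn (dot u_i x))_i] is below
   a fixed realized sign vector [t], and it is a [k]-face iff [t] has [d - k]
   zeros.  Summing over the sets [Z] of zeros, deletion-restriction counts the
   realized sign vectors, which gives ['C(n, d - k) * C(n - d + k, k)] faces of
   dimension [k].  By general position every sign vector above a realized one
   with at most [d + 1] zeros is again realized, so each [l]-face lies in
   ['C(d - l, d - k) * 2 ^ (k - l)] faces of dimension [k].  Double counting
   the incidences gives the ratio.

   For general position, complete [m] of the vectors to a square matrix by the
   last vectors of the canonical basis and let [m] grow: the determinant is the
   inner product of the [m]-th vector with a vector of cofactors that depends
   on the others only, and that is nonzero because one of its coordinates is
   the determinant of the previous step.  By Fubini's theorem the determinant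
   vanishes with probability zero. *)

Require Import Defs.
From HB Require Import structures.
From mathcomp Require Import all_boot all_order all_algebra.
From mathcomp Require Import finmap.
From mathcomp Require Import all_classical all_reals all_analysis.
From mathcomp Require Import measurable_realfun.
From mathcomp Require Import ring lra zify.
Import Order.TTheory GRing.Theory Num.Theory numFieldNormedType.Exports.

Set Implicit Arguments.
Unset Strict Implicit.
Unset Printing Implicit Defensive.

Local Open Scope classical_set_scope.
Local Open Scope ring_scope.

(** * The Euclidean dot product and radial projection onto the sphere *)

Section Dot.
Variables (R : realType) (d : nat).
Implicit Types x y v : 'rV[R]_d.+1.

Lemma dotC x y : dot x y = dot y x.
Proof. by rewrite /dot; apply: eq_bigr => i _; rewrite mulrC. Qed.

Lemma dotDr x y v : dot x (y + v) = dot x y + dot x v.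
Proof. by rewrite /dot -big_split; apply: eq_bigr => i _; rewrite mxE mulrDr. Qed.

Lemma dotZr x (c : R) y : dot x (c *: y) = c * dot x y.
Proof.
by rewrite /dot mulr_sumr; apply: eq_bigr => i _; rewrite mxE mulrCA.
Qed.

Lemma dotNr x y : dot x (- y) = - dot x y.
Proof. by rewrite -scaleN1r dotZr mulN1r. Qed.

Lemma dotBr x y v : dot x (y - v) = dot x y - dot x v.
Proof. by rewrite dotDr dotNr. Qed.

Lemma dot0r x : dot x 0 = 0.
Proof. by rewrite -(scale0r x) dotZr mul0r. Qed.

Lemma dotDl x y v : dot (x + y) v = dot x v + dot y v.
Proof. by rewrite dotC dotDr !(dotC v). Qed.

Lemma dotZl x (c : R) y : dot (c *: x) y = c * dot x y.
Proof. by rewrite dotC dotZr dotC. Qed.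

Lemma dotNl x y : dot (- x) y = - dot x y.
Proof. by rewrite dotC dotNr dotC. Qed.

Lemma dot0l y : dot 0 y = 0.
Proof. by rewrite dotC dot0r. Qed.

Lemma dot_suml (I : finType) (c : I -> 'rV[R]_d.+1) y :
  dot (\sum_i c i) y = \sum_i dot (c i) y.
Proof.
by elim/big_rec2: _ => [|i a b _ <-]; rewrite ?dot0l ?dotDl.
Qed.

Lemma dot_ge0 x : 0 <= dot x x.
Proof. by apply: sumr_ge0 => i _; rewrite -expr2 sqr_ge0. Qed.

Lemma dot_eq0 x : (dot x x == 0) = (x == 0).
Proof.
apply/eqP/eqP => [x0|->]; last by rewrite dot0r.
apply/rowP => i; rewrite mxE; apply/eqP.
move/eqP: x0; rewrite psumr_eq0 => [/allP/(_ i)|j _]; last by rewrite -expr2 sqr_ge0.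
by rewrite mem_index_enum /= mulf_eq0 orbb => ->.
Qed.

Lemma dot_gt0 x : (0 < dot x x) = (x != 0).
Proof. by rewrite lt_neqAle dot_ge0 andbT eq_sym dot_eq0. Qed.

Definition normalize x := (Num.sqrt (dot x x))^-1 *: x.

Lemma normalize_gt0 x : x != 0 -> 0 < (Num.sqrt (dot x x))^-1.
Proof. by move=> x0; rewrite invr_gt0 sqrtr_gt0 dot_gt0. Qed.

Lemma sphere_normalize x : x != 0 -> sphere R d (normalize x).
Proof.
move=> x0; rewrite /sphere /= dotZr dotZl mulrA -invfM -expr2.
by rewrite sqr_sqrtr ?dot_ge0// mulVf// dot_eq0.
Qed.

Lemma sphere_neq0 x : sphere R d x -> x != 0.
Proof. by move=> /= x1; rewrite -dot_eq0 x1 oner_eq0. Qed.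

Lemma normalize_id x : sphere R d x -> normalize x = x.
Proof. by rewrite /sphere/normalize/= => ->; rewrite sqrtr1 invr1 scale1r. Qed.

End Dot.

(** * Sign vectors and cones *)

Section Covector.
Variables (R : realType) (d n : nat) (u : 'I_n -> 'rV[R]_d.+1).
Implicit Types (x y v : 'rV[R]_d.+1) (t : {ffun 'I_n -> option bool}).

(** Signs form a finite type, so that faces can be counted as finite sets of sign vectors. *)
Definition sgn (a : R) : option bool := if a == 0 then None else Some (0 < a).

Lemma sgn_None a : (sgn a == None) = (a == 0).
Proof. by rewrite /sgn; case: (a == 0). Qed.

Lemma sgn_pos c a : 0 < c -> sgn (c * a) = sgn a.
Proof. by move=> c0; rewrite /sgn mulf_eq0 (gt_eqF c0) pmulr_rgt0. Qed.

Lemma sgn_true a : (sgn a == Some true) = (0 < a).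
Proof. by rewrite /sgn; case: (ltgtP 0 a); rewrite ?eqE. Qed.

Lemma sgn_false a : (sgn a == Some false) = (a < 0).
Proof. by rewrite /sgn; case: (ltgtP 0 a); rewrite ?eqE. Qed.

Lemma sgn0 : sgn 0 = None.
Proof. by rewrite /sgn eqxx. Qed.

Definition covector x : {ffun 'I_n -> option bool} :=
  [ffun i => sgn (dot (u i) x)].

(** The face order on the covectors of an oriented matroid; [sign_comp] below is their
    composition. *)
Definition sle t t' := [forall i, (t i == None) || (t i == t' i)].

Definition zeros t : {set 'I_n} := [set i | t i == None].

Definition sign_comp t t' : {ffun 'I_n -> option bool} :=
  [ffun i => if t i == None then t' i else t i].

Definition realized t := `[< exists x, covector x = t >].

Definition cone t : set 'rV[R]_d.+1 := [set x | sle (covector x) t].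

Lemma sleP t t' : reflect (forall i, t i != None -> t i = t' i) (sle t t').
Proof.
apply: (iffP forallP) => [h i|h i].
  by have := h i => /orP[/eqP->//|/eqP].
by case: eqP => //= /eqP /h ->.
Qed.

Lemma sle_refl t : sle t t.
Proof. by apply/sleP. Qed.

Lemma sle_trans t2 t1 t3 : sle t1 t2 -> sle t2 t3 -> sle t1 t3.
Proof.
move=> /sleP h /sleP h'; apply/sleP => i ti.
by rewrite h// h'// -h.
Qed.

Lemma sle_anti t1 t2 : sle t1 t2 -> sle t2 t1 -> t1 = t2.
Proof.
move=> /sleP h /sleP h'; apply/ffunP => i.
have [ti|/h//] := eqVneq (t1 i) None.
by have [->//|/h'//] := eqVneq (t2 i) None.
Qed.

Lemma sle_comp t t' : sle t (sign_comp t t').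
Proof. by apply/sleP => i; rewrite ffunE => /negbTE ->. Qed.

Lemma comp_sle t t1 t2 : sle t1 t -> sle t2 t -> sle (sign_comp t1 t2) t.
Proof.
move=> /sleP h1 /sleP h2; apply/sleP => i; rewrite ffunE.
by case: ifPn => [_ /h2|/h1].
Qed.

Lemma sle_zeros t t' : sle t t' -> zeros t' \subset zeros t.
Proof.
move=> /sleP h; apply/fintype.subsetP => i; rewrite !inE; apply: contraTT => ti.
by rewrite -h.
Qed.

Lemma covectorZ c x : 0 < c -> covector (c *: x) = covector x.
Proof. by move=> c0; apply/ffunP => i; rewrite !ffunE dotZr sgn_pos. Qed.

Lemma covector0 : covector 0 = [ffun=> None].
Proof. by apply/ffunP => i; rewrite !ffunE dot0r sgn0. Qed.

Lemma in_zeros x i : (i \in zeros (covector x)) = (dot (u i) x == 0).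
Proof. by rewrite inE ffunE sgn_None. Qed.

Lemma cone_covector x : cone (covector x) x.
Proof. exact: sle_refl. Qed.

Lemma cone0 t : cone t 0.
Proof. by apply/sleP => i; rewrite covector0 ffunE. Qed.

(** A small step along [v] cannot change a nonzero sign of [x]; where [x] vanishes, only [v]
    contributes. *)
Lemma covector_perturb x v : exists2 e : R, 0 < e &
  covector (x + e *: v) = sign_comp (covector x) (covector v).
Proof.
(* The step is [s^-1]. The summand 1 makes [s] strictly larger than each ratio; ratios with
   denominator zero are 0 by convention. *)
pose s := 1 + \sum_i (`|dot (u i) v| / `|dot (u i) x|).
have s1 : 1 <= s by rewrite lerDl sumr_ge0// => i _; rewrite divr_ge0.
have s0 : 0 < s by apply: lt_le_trans s1.
exists s^-1; rewrite ?invr_gt0//.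
apply/ffunP => i; rewrite !ffunE dotDr dotZr sgn_None.
case: eqVneq => [->|xi]; first by rewrite add0r sgn_pos// invr_gt0.
have lt : `|s^-1 * dot (u i) v| < `|dot (u i) x|.
  rewrite normrM gtr0_norm ?invr_gt0// mulrC ltr_pdivrMr// mulrC -ltr_pdivrMr ?normr_gt0//.
  rewrite /s (bigD1 i)//= addrCA ltrDl ltr_wpDr//.
  by rewrite sumr_ge0// => j _; rewrite divr_ge0.
rewrite /sgn (negbTE xi) ifN.
  congr Some.
  move: lt; rewrite ltr_norml; case: (ltgtP 0 (dot (u i) x)) xi => [p|p|->] //.
    by rewrite gtr0_norm// => _ /andP[] *; lra.
  by rewrite ltr0_norm// => _ /andP[] *; apply/negbTE; lra.
apply: contraTN lt => /eqP h.
have -> : dot (u i) x = - (s^-1 * dot (u i) v) by lra.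
by rewrite normrN ltxx.
Qed.

Lemma realized_covector x : realized (covector x).
Proof. by apply/asboolP; exists x. Qed.

Lemma realized_comp t t' : realized t -> realized t' -> realized (sign_comp t t').
Proof.
move=> /asboolP[x <-] /asboolP[y <-].
by have [e _ <-] := covector_perturb x y; exact: realized_covector.
Qed.

Lemma cone_inj t t' : realized t -> realized t' -> cone t = cone t' -> t = t'.
Proof.
move=> /asboolP[x <-] /asboolP[y <-] h; apply: sle_anti.
  by have := cone_covector x; rewrite h.
by have := cone_covector y; rewrite -h.
Qed.

Lemma cone_sle t t' : sle t t' -> cone t `<=` cone t'.
Proof. by move=> tt' x; rewrite /cone /= => /sle_trans; apply. Qed.

Lemma cone_coord t x : cone t x <-> forall i,
  match t i return Prop with
  | None => dot (u i) x = 0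
  | Some true => 0 <= dot (u i) x
  | Some false => dot (u i) x <= 0 end.
Proof.
rewrite /cone /=; split.
  move=> /forallP h i; have := h i; rewrite ffunE /sgn.
  by case: (t i) => [[]|]; case: (ltgtP 0 (dot (u i) x)).
move=> h; apply/forallP => i; have := h i; rewrite ffunE /sgn.
by case: (t i) => [[]|]; [case: (ltgtP 0 (dot (u i) x))..|move->; rewrite eqxx].
Qed.

End Covector.

(** * Images of finite sets and their cardinality *)

Lemma mem_fset_set_image (T : finType) (U : choiceType) (A : {set T}) (f : T -> U) :
  fset_set (f @` [set` A]) =i [seq f x | x in A].
Proof.
move=> y; rewrite in_fset_set; last exact: finite_image.
apply/idP/fintype.imageP => [|[x xA ->]]; rewrite in_setE.
  by move=> [x xA <-]; exists x.
by exists x.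
Qed.

Lemma perm_fset_set_image (T : finType) (U : choiceType) (A : {set T}) (f : T -> U) :
  {in A &, injective f} ->
  perm_eq (fset_set (f @` [set` A])) [seq f x | x in A].
Proof.
move=> fI; apply: uniq_perm; [exact: fset_uniq| |exact: mem_fset_set_image].
by rewrite map_inj_in_uniq ?enum_uniq// => x y; rewrite !mem_enum; exact: fI.
Qed.

Lemma card_fset_set_image (T : finType) (U : choiceType) (A : {set T}) (f : T -> U) :
  {in A &, injective f} -> #|` fset_set (f @` [set` A])|%fset = #|A|.
Proof. by move=> /perm_fset_set_image/perm_size ->; rewrite size_map -cardE. Qed.

(** * Faces of the cones of an arrangement in general position *)

Section Faces.
Variables (R : realType) (d n : nat) (u : 'I_n -> 'rV[R]_d.+1).
Implicit Types (x y v : 'rV[R]_d.+1) (t : {ffun 'I_n -> option bool}).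
Implicit Types (C G : set 'rV[R]_d.+1) (Z : {set 'I_n}).

(** Equivalent to the linear independence of any at most [d.+1] of the vectors, in the form in which
    it is applied: their dot products can be prescribed. *)
Definition general_position := forall Z (c : 'I_n -> R),
  (#|Z| <= d.+1)%N -> exists v, forall i, i \in Z -> dot (u i) v = c i.

Definition eval_lin Z : 'Hom('rV[R]_d.+1, 'rV[R]_#|Z|) :=
  linfun (mulmxr (\matrix_(i < d.+1, j < #|Z|) u (enum_val j) ord0 i)).

Definition vanish Z : {vspace 'rV[R]_d.+1} := lker (eval_lin Z).

Lemma eval_linE Z x (j : 'I_#|Z|) :
  eval_lin Z x ord0 j = dot (u (enum_val j)) x.
Proof. by rewrite lfunE /= mxE; apply: eq_bigr => i _; rewrite mxE mulrC. Qed.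

Lemma mem_vanish Z x :
  reflect (forall i, i \in Z -> dot (u i) x = 0) (x \in vanish Z).
Proof.
rewrite memv_ker; apply: (iffP eqP) => [h i iZ|h].
  by rewrite -(enum_rankK_in iZ iZ) -eval_linE h mxE.
by apply/rowP => j; rewrite eval_linE h ?mxE//; exact: enum_valP.
Qed.

Lemma vanishS Z Z' : Z \subset Z' -> (vanish Z' <= vanish Z)%VS.
Proof.
move=> ZZ'; apply/subvP => x /mem_vanish h; apply/mem_vanish => i iZ.
by rewrite h// (fintype.subsetP ZZ').
Qed.

(** A point [x] with covector [t] is relatively interior: if [v] vanishes on the zeros of [t], a
    small [x + e *: v] stays in the cone, so [v] is a combination of two points of the cone. *)
Lemma vanish_hull t : realized u t ->
  is_linear_hull (cone u t) (vanish (zeros t)).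
Proof.
move=> /asboolP[x tx]; split=> [y yt|L hL].
  apply/mem_vanish => i it; apply/eqP; rewrite -in_zeros.
  exact: (fintype.subsetP (sle_zeros yt)).
apply/subvP => v /mem_vanish vZ.
have [e e0 h] := covector_perturb u x v.
have xL : x \in L by apply: hL; rewrite /cone/= tx sle_refl.
have : x + e *: v \in L.
  apply: hL; rewrite /cone/= h tx; apply/sleP => i; rewrite ffunE.
  case: ifPn => // ti; rewrite ffunE vZ ?sgn0//.
  by rewrite inE.
move=> xv; have -> : v = e^-1 *: (x + e *: v - x).
  by rewrite addrAC subrr add0r scalerA mulVf ?scale1r// gt_eqF.
by rewrite memvZ// memvB.
Qed.

Lemma exists_subset_card Z k : (k <= #|Z|)%N ->
  exists2 Z' : {set 'I_n}, Z' \subset Z & #|Z'| = k.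
Proof.
move=> kZ; have : (0 < #|[set A : {set 'I_n} | A \subset Z & #|A| == k]%SET|)%N.
  by rewrite cards_draws bin_gt0.
by case/card_gt0P => A; rewrite inE => /andP[AZ /eqP]; exists A.
Qed.

Hypothesis gp : general_position.

(** Rank-nullity: [eval_lin Z] is surjective when [#|Z| <= d.+1]. A larger [Z] has a subset of size
    [d.+1] whose space is already zero, in agreement with truncated subtraction. *)
Lemma dim_vanish Z : \dim (vanish Z) = (d.+1 - #|Z|)%N.
Proof.
wlog Zd : Z / (#|Z| <= d.+1)%N.
  move=> h; have [/h//|dZ] := leqP #|Z| d.+1.
  have [Z' Z'Z Z'd] := exists_subset_card (ltnW dZ).
  have := h Z'; rewrite Z'd subnn => /(_ (leqnn _)) /eqP.
  rewrite dimv_eq0 => /eqP V0.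
  have := vanishS Z'Z; rewrite V0 subv0 => /eqP ->.
  by rewrite dimv0; apply/esym/eqP; rewrite subn_eq0 ltnW.
have := limg_ker_dim (eval_lin Z) fullv; rewrite capfv.
suff -> : (eval_lin Z @: fullv)%VS = fullv.
  have dimE m : dim 'rV[R]_m = m by rewrite dim_matrix; exact: mul1n.
  rewrite !dimvf !dimE -/(vanish Z) => h.
  by apply/eqP; rewrite -(eqn_add2r #|Z|) h subnK.
apply/eqP; rewrite eqEsubv subvf/=; apply/subvP => c _.
have [v hv] := gp (fun i => \sum_(j < #|Z| | enum_val j == i) c ord0 j) Zd.
apply/memv_imgP; exists v; rewrite ?memvf//.
apply/rowP => j; rewrite eval_linE hv; last exact: enum_valP.
by rewrite (big_pred1 j)// => k; rewrite (inj_eq enum_val_inj).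
Qed.

Lemma cone_has_dimE t m : realized u t ->
  cone_has_dim (cone u t) m <-> m = (d.+1 - #|zeros t|)%N.
Proof.
move=> rt; have [h1 h2] := vanish_hull rt; rewrite -dim_vanish; split.
  move=> [L [hL1 hL2] <-]; congr (\dim _); apply/eqP.
  by rewrite eqEsubv hL2// h2.
by move=> ->; exists (vanish (zeros t)).
Qed.

(** A realizing point can be normalized unless it is 0. Then all signs are zero, and any nonzero
    vector of the vanishing space, which has positive dimension, realizes them too. *)
Lemma realized_sphere t : realized u t -> (#|zeros t| <= d)%N ->
  exists2 x, sphere R d x & covector u x = t.
Proof.
move=> /asboolP[x tx] td.
have [y y0 yt] : exists2 y, y != 0 & covector u y = t.
  have [x0|x0] := eqVneq x 0; last by exists x.
  have : vanish (zeros t) != 0%VS by rewrite -dimv_eq0 dim_vanish -lt0n subn_gt0.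
  rewrite -subv0 => /subvPn[y /mem_vanish yZ]; rewrite memv0 => y0.
  exists y => //; rewrite -tx x0 covector0; apply/ffunP => i.
  rewrite !ffunE yZ ?sgn0// inE -tx x0 covector0 ffunE.
  by [].
exists (normalize y); first exact: sphere_normalize.
by rewrite covectorZ// normalize_gt0.
Qed.

Lemma polyhedral_cone_fin (T : finType) (a : T -> 'rV[R]_d.+1) :
  polyhedral_cone [set x | forall i, dot (a i) x <= 0].
Proof.
exists #|T|, (fun i => a (enum_val i)); apply/seteqP; split=> x /= h i //.
by rewrite -(enum_rankK i).
Qed.

Lemma polyhedral_cone_cone t : polyhedral_cone (cone u t).
Proof.
(* A zero entry of [t] is an equation, encoded by two opposite inequalities between which the
   boolean selects. *)
pose a (p : 'I_n * bool) := match t p.1 with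
  | Some true => - u p.1 | Some false => u p.1
  | None => if p.2 then u p.1 else - u p.1 end.
suff -> : cone u t = [set x | forall i, dot (a i) x <= 0].
  exact: polyhedral_cone_fin.
apply/seteqP; split => [x /cone_coord h [i b]|x h]; rewrite /a /=.
  have := h i; case: (t i) => [[]|]; rewrite ?dotNl ?oppr_le0//.
  by case: b => [->|]; rewrite // dotNl => ->; rewrite oppr0.
apply/cone_coord => i; have := h (i, true); have := h (i, false).
rewrite /a/=; case: (t i) => [[]|]; rewrite ?dotNl ?oppr_le0// => h1 h2.
by apply/le_anti/andP.
Qed.

Lemma polyhedral_coneZ C c x : polyhedral_cone C -> 0 <= c -> C x -> C (c *: x).
Proof.
by move=> [m [a ->]] c0 /= h i; rewrite dotZr mulr_ge0_le0.
Qed.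

Lemma polyhedral_cone0 C : polyhedral_cone C -> C 0.
Proof. by move=> [m [a ->]] /= i; rewrite dot0r. Qed.

(** A polyhedral cone contains 0 and is closed under nonnegative scaling, so its points on the
    sphere recover it. *)
Lemma polyhedral_cone_sphere_inj C C' :
  polyhedral_cone C -> polyhedral_cone C' ->
  C `&` sphere R d = C' `&` sphere R d -> C = C'.
Proof.
wlog suff : C C' / polyhedral_cone C -> polyhedral_cone C' ->
    C `&` sphere R d = C' `&` sphere R d -> C `<=` C'.
  by move=> h pC pC' e; apply/seteqP; split; exact: h.
move=> pC pC' e x Cx; have [->|x0] := eqVneq x 0; first exact: polyhedral_cone0.
have [] : (C' `&` sphere R d) (normalize x).
  rewrite -e; split; last exact: sphere_normalize.
  by apply: polyhedral_coneZ => //; rewrite ltW ?normalize_gt0.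
move=> C'x _.
have -> : x = Num.sqrt (dot x x) *: normalize x.
  rewrite /normalize scalerA divff ?scale1r// gt_eqF//.
  by rewrite -invr_gt0 normalize_gt0.
by apply: polyhedral_coneZ => //; exact: sqrtr_ge0.
Qed.

Lemma cone_face_cone t t' : sle t' t -> cone_face (cone u t) (cone u t').
Proof.
move=> t't.
(* The supporting functional sums the normals at the entries that [t'] sets to zero, signed to be
   nonpositive on the cone; the sum vanishes only if each term does. *)
pose a i : 'rV[R]_d.+1 := if t' i == None then match t i with
  | Some true => - u i | Some false => u i | None => 0 end else 0.
have a0 x : cone u t x -> forall i, dot (a i) x <= 0.
  move=> /cone_coord h i; have := h i; rewrite /a; case: ifP; rewrite ?dot0l//.
  by case: (t i) => [[]|] _; rewrite ?dot0l ?dotNl ?oppr_le0.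
exists (\sum_i a i).
  by move=> x h; rewrite dot_suml sumr_le0// => i _; exact: a0.
apply/seteqP; split => x.
  move=> xt'; split; first exact: cone_sle xt'.
  rewrite /= dot_suml big1// => i _; rewrite /a.
  case: ifP; last by rewrite dot0l.
  move/eqP => ti; move/cone_coord: xt' => /(_ i); rewrite ti.
  by case: (t i) => [[]|] h; rewrite ?dotNl ?dot0l ?h ?oppr0.
move=> [xt /=]; rewrite dot_suml => /eqP.
rewrite -oppr_eq0 -sumrN psumr_eq0 => [|i _]; last by rewrite oppr_ge0 a0.
move=> /allP h; apply/cone_coord => i.
have := h i; rewrite mem_index_enum oppr_eq0 /a /= => /(_ isT) /eqP.
move/cone_coord: xt => /(_ i); move/sleP: t't => /(_ i).
case: (t' i) => [b|] /=; first by move=> <-.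
by case: (t i) => [[]|] _ //; rewrite dotNl => _ /eqP; rewrite oppr_eq0 => /eqP.
Qed.

(* A point [x] of the face with the fewest vanishing coordinates lies in its
   relative interior: its covector absorbs those of all points of the face,
   and conversely [x - e *: y] stays in the cone for [y] in [cone (covector x)]. *)
Lemma cone_faceP t G : cone_face (cone u t) G ->
  exists x, sle (covector u x) t /\ G = cone u (covector u x).
Proof.
move=> [a ha ->]; set F := _ `&` _.
have F0 : F 0 by split; [exact: cone0|rewrite /= dot0r].
pose Q k := `[< exists2 x, F x & #|zeros (covector u x)| = k >].
have exQ : exists k, Q k by exists #|zeros (covector u 0)|; apply/asboolP; exists 0.
have [k /asboolP[x [xt ax] xk] kmin] := ex_minnP exQ.
exists x; split => //; apply/seteqP; split=> y.
  move=> [yt ay].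
  have [e e0 he] := covector_perturb u x y.
  have Qxy : Q #|zeros (covector u (x + e *: y))|.
    apply/asboolP; exists (x + e *: y) => //; split.
      by rewrite /cone/= he; exact: comp_sle.
    by rewrite /= dotDr dotZr ax ay mulr0 addr0.
  have := kmin _ Qxy; rewrite -xk he => le.
  have : zeros (sign_comp (covector u x) (covector u y)) = zeros (covector u x).
    by apply/eqP; rewrite eqEcard le andbT; apply: sle_zeros; exact: sle_comp.
  move=> /setP ze; apply/sleP => i yi.
  have := ze i; rewrite !inE ffunE; case: ifPn => [xi /eqP|xi _].
    by move/eqP; rewrite (negbTE yi).
  by move/sleP: yt => ->//; move/sleP: xt => ->.
move=> yx; have yt : cone u t y by apply: cone_sle yx.
split => //=.
have [e e0 he] := covector_perturb u x (- y).
have : dot a (x + e *: - y) <= 0.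
  apply: ha; apply: (@cone_sle _ _ _ _ (covector u x)) => //.
  rewrite /cone/= he; apply/sleP => i; rewrite ffunE; case: ifPn => // /eqP xi.
  rewrite ffunE dotNr; have : i \in zeros (covector u y).
    by apply: (fintype.subsetP (sle_zeros yx)); rewrite inE xi.
  by rewrite in_zeros => /eqP->; rewrite oppr0 sgn0.
rewrite dotDr dotZr dotNr ax add0r pmulr_rle0// oppr_le0 => h.
by apply/le_anti/andP; split => //; exact: ha.
Qed.

Lemma cone_neq0 t : realized u t -> (#|zeros t| <= d)%N -> cone u t <> [set 0].
Proof.
move=> rt td; have [x xS xt] := realized_sphere rt td => h.
have : cone u t x by rewrite -xt; exact: cone_covector.
by rewrite h /= => x0; have := sphere_neq0 xS; rewrite x0 eqxx.
Qed.

Definition faces_below l t : {set {ffun 'I_n -> option bool}} :=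
  [set t' | [&& realized u t', sle t' t & #|zeros t'| == (d - l)%N]]%SET.

Definition sph_cone t := cone u t `&` sphere R d.

Lemma sph_cone_inj t t' : realized u t -> realized u t' ->
  sph_cone t = sph_cone t' -> t = t'.
Proof.
move=> rt rt' e; apply: (cone_inj rt rt').
by apply: polyhedral_cone_sphere_inj => //; exact: polyhedral_cone_cone.
Qed.

(** Faces of the cone correspond to realized sign vectors below [t]; an [l]-face comes from a cone
    of dimension [l.+1], hence from [d - l] zeros. *)
Lemma sph_faces_cone l t : (l <= d)%N -> realized u t -> (#|zeros t| <= d)%N ->
  sph_faces l (sph_cone t) = sph_cone @` [set` faces_below l t].
Proof.
move=> ld rt td.
have cd t' : realized u t' ->
    cone_has_dim (cone u t') l.+1 <-> #|zeros t'| = (d - l)%N.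
  by move=> rt'; rewrite cone_has_dimE//; lia.
apply/seteqP; split=> Q /=.
  move=> [C [G [[pC C0 eC] [fG dG eQ]]]].
  have eCt : C = cone u t.
    by apply: polyhedral_cone_sphere_inj => //; exact: polyhedral_cone_cone.
  move: fG; rewrite eCt => /cone_faceP[x [xt eG]].
  exists (covector u x); last by rewrite eQ eG.
  rewrite /= inE realized_covector xt /=; apply/eqP/cd; first exact: realized_covector.
  by rewrite -eG.
move=> [t']; rewrite /= inE => /and3P[rt' t't /eqP zt'] <-.
exists (cone u t), (cone u t'); split; split => //.
- exact: polyhedral_cone_cone.
- exact: cone_neq0.
- exact: cone_face_cone.
- exact/cd.
Qed.

Lemma face_number_cone l t : (l <= d)%N -> realized u t -> (#|zeros t| <= d)%N ->
  face_number l (sph_cone t) = #|faces_below l t|.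
Proof.
move=> ld rt td; rewrite /face_number sph_faces_cone// card_fset_set_image//.
move=> t1 t2; rewrite !inE => /and3P[r1 _ _] /and3P[r2 _ _].
exact: sph_cone_inj.
Qed.

End Faces.
(** * Counting faces and incidences *)

(** The number of regions of [m] hyperplanes in general position in a linear space of dimension [e].
    For [e = 0] and [m > 0] it is 0: the only point lies on every hyperplane. *)
Fixpoint region_number (e m : nat) : nat :=
  match m, e with
  | 0, _ => 1
  | _.+1, 0 => 0
  | m'.+1, e'.+1 => region_number e m' + region_number e' m'
  end%N.

(** Pascal's rule turns the recursion into the binomial sum; the step from [m = 0] is separate
    because the binomial formula starts at one hyperplane. *)
Lemma region_number_cell j m : region_number j.+1 m = cell_number m j.
Proof.
elim: m j => [//|m IH] j; rewrite [LHS]/= IH.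
case: m IH => [|m] IH.
  rewrite /cell_number/= big_ord_recl/= big1// => i _; exact: bin0n.
case: j => [|j]; first by rewrite /cell_number/= addn0 !big_ord1 !bin0.
rewrite IH /cell_number/= -mulnDr; congr (2 * _)%N.
rewrite big_ord_recl [RHS]big_ord_recl !bin0 -addnA; congr addn.
by rewrite -big_split/=; apply: eq_bigr => i _; rewrite binS.
Qed.

(** * Counting regions and faces by deletion and restriction *)

Section Count.
Variables (R : realType) (d n : nat) (u : 'I_n -> 'rV[R]_d.+1).
Implicit Types (x y v : 'rV[R]_d.+1) (t : {ffun 'I_n -> option bool}).
Implicit Types (A Z : {set 'I_n}).
Hypothesis gp : general_position u.

Definition restrict A t : {ffun 'I_n -> option bool} :=
  [ffun i => if i \in A then t i else None].

(** The hyperplanes in [A] are arranged inside [vanish u Z]; signs outside [A] are padded with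
    [None] so that all regions share one type. *)
Definition is_region Z A t x := [/\ x \in vanish u Z,
  forall i, i \in A -> dot (u i) x != 0 & restrict A (covector u x) = t].

Definition regions Z A : {set {ffun 'I_n -> option bool}} :=
  [set t | `[< exists x, is_region Z A t x >]]%SET.

Lemma sgn_comb (c1 c2 p q : R) : 0 < c1 -> 0 < c2 -> sgn p = sgn q ->
  sgn (c1 * p + c2 * q) = sgn p.
Proof.
move=> c10 c20; rewrite -(sgn_pos p c10) -(sgn_pos q c20).
move: (_ * p) (_ * q) => {}p {}q; rewrite /sgn.
case: (ltgtP 0 p) => hp; case: (ltgtP 0 q) => hq //=; rewrite -?hp -?hq ?add0r ?addr0 ?eqxx// => _.
  by have pq0 := addr_gt0 hp hq; rewrite gt_eqF// pq0 hp.
have pq0 : p + q < 0 by lra.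
by rewrite lt_eqF// ltNge ltW.
Qed.

Section Step.
Variables (Z A : {set 'I_n}) (a : 'I_n).
Hypotheses (aA : a \in A) (ZA : [disjoint Z & A]%B) (Zd : (#|Z| <= d)%N).

Let side b := [set t in regions Z A | t a == Some b]%SET.

Lemma mem_restrict_side b t : t \in [set restrict (A :\ a)%SET t | t in side b]%SET ->
  exists x, is_region Z (A :\ a)%SET t x /\ sgn (dot (u a) x) = Some b.
Proof.
case/imsetP => s; rewrite !inE => /andP[/asboolP[x [xZ xA <-]] /eqP sa] ->.
exists x; split; last by move: sa; rewrite !ffunE aA.
split => //; first by move=> i /setD1P[_]; exact: xA.
by apply/ffunP => i; rewrite !ffunE !inE; case: (i \in A); rewrite ?andbF.
Qed.

Lemma restrict_side b t x : is_region Z (A :\ a)%SET t x ->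
  sgn (dot (u a) x) = Some b ->
  t \in [set restrict (A :\ a)%SET t | t in side b]%SET.
Proof.
move=> [xZ xA <-] xa; apply/imsetP; exists (restrict A (covector u x)).
  rewrite !inE !ffunE aA xa eqxx andbT; apply/asboolP; exists x; split => // i iA.
  have [->|ia] := eqVneq i a; first by rewrite -sgn_None xa.
  by rewrite xA// !inE ia.
by apply/ffunP => i; rewrite !ffunE !inE; case: (i \in A); rewrite ?andbF.
Qed.

(** A region met by the hyperplane of [a] reaches both of its sides: since [a |: Z] has at most
    [d.+1] elements, some direction inside [vanish u Z] has any chosen sign on [u a]. *)
Lemma region_perturb b t x : is_region Z (A :\ a)%SET t x -> dot (u a) x = 0 ->
  exists y, is_region Z (A :\ a)%SET t y /\ sgn (dot (u a) y) = Some b.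
Proof.
move=> [xZ xA xt] xa.
have aZ : a \notin Z by apply: contraTN aA => aZ; rewrite (disjointFr ZA).
have [|v hv] := gp (Z := a |: Z) (fun i => if i == a then (-1) ^+ (~~ b) else 0).
  by rewrite cardsU1 aZ.
have [e e0 he] := covector_perturb u x v.
have xe i : i \in (A :\ a)%SET -> covector u (x + e *: v) i = covector u x i.
  by move=> /xA xi; rewrite he ffunE ffunE sgn_None (negbTE xi).
exists (x + e *: v); split; last first.
  have -> : sgn (dot (u a) (x + e *: v)) = covector u (x + e *: v) a by rewrite ffunE.
  rewrite he !ffunE xa sgn0/= hv ?setU11// eqxx; apply/eqP.
  by case: b {hv} => /=; rewrite ?sgn_true ?sgn_false; lra.
split.
- apply/memvD => //; apply: memvZ; apply/mem_vanish => i iZ.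
  rewrite hv ?inE ?iZ ?orbT//; case: eqVneq => // ia.
  by rewrite -ia iZ in aZ.
- move=> i iA; rewrite -sgn_None; have := xe _ iA; rewrite !ffunE => ->.
  by rewrite sgn_None xA.
rewrite -xt; apply/ffunP => i; rewrite ffunE [RHS]ffunE.
by case: ifP => // /xe.
Qed.

(** Forgetting [a] is injective on each side of its hyperplane. The union of the two images is the
    deletion; their intersection consists of the regions cut by the hyperplane, which are those of
    the restriction. *)
Lemma card_regions_step :
  #|regions Z A| = (#|regions Z (A :\ a)%SET| + #|regions (a |: Z) (A :\ a)%SET|)%N.
Proof.
have cardS b : #|[set restrict (A :\ a)%SET t | t in side b]%SET| = #|side b|.
  apply: card_in_imset => s t; rewrite !inE => /andP[/asboolP[x [_ _ <-]] /eqP sa].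
  move=> /andP[/asboolP[y [_ _ <-]] /eqP ta] /ffunP h; apply/ffunP => i.
  have := h i; rewrite !ffunE !inE.
  have [->|ia] := eqVneq i a; last by case: (i \in A).
  by move: sa ta; rewrite !ffunE => -> ->.
have -> : regions Z A = (side true :|: side false)%SET.
  apply/setP => t; rewrite !inE -andb_orr; case: asboolP => //= -[x [_ xA <-]].
  rewrite ffunE aA ffunE; have := xA _ aA; rewrite -sgn_None.
  by case: sgn => [[]|].
rewrite cardsU (_ : _ :&: _ = finset.set0)%SET ?cards0 ?subn0; last first.
  apply/setP => t; rewrite !inE; apply/negP => /andP[/andP[_ /eqP->]].
  by rewrite andbC.
rewrite -!cardS -cardsUI; congr (_ + _)%N; apply: eq_card => t.
  apply/idP/idP.
    by rewrite inE => /orP[] /mem_restrict_side[x [xt _]]; rewrite inE; apply/asboolP; exists x.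
  rewrite inE => /asboolP[x xt]; rewrite inE.
  case xa : (sgn (dot (u a) x)) => [[]|].
  - by rewrite (restrict_side xt xa).
  - by rewrite (restrict_side xt xa) orbT.
  move/eqP : xa; rewrite sgn_None => /eqP xa.
  have [y [yt ya]] := region_perturb true xt xa.
  by rewrite (restrict_side yt ya).
apply/idP/idP.
  rewrite inE => /andP[/mem_restrict_side[x [[xZ xA xt] /eqP xa]]].
  move=> /mem_restrict_side[y [[yZ yA yt] /eqP ya]].
  rewrite sgn_true in xa; rewrite sgn_false -oppr_gt0 in ya.
  (* Both coefficients are positive, so [z] keeps the signs common to [x] and [y]; they are chosen
     to make [u a] vanish at [z]. *)
  pose z := dot (u a) x *: y + (- dot (u a) y) *: x.
  have zxy i : i \in (A :\ a)%SET -> sgn (dot (u i) z) = sgn (dot (u i) x).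
    move=> iA; have : sgn (dot (u i) y) = sgn (dot (u i) x).
      have := congr1 (fun f : {ffun _ -> _} => f i) (etrans yt (esym xt)).
      by rewrite !ffunE iA.
    by move=> e; rewrite -e /z dotDr !dotZr sgn_comb.
  rewrite inE; apply/asboolP; exists z; split.
  - apply/mem_vanish => i /setU1P[->|iZ].
      by rewrite /z dotDr !dotZr; ring.
    move/mem_vanish: xZ => xZ; move/mem_vanish: yZ => yZ.
    by rewrite /z dotDr !dotZr (xZ _ iZ) (yZ _ iZ) !mulr0 addr0.
  - by move=> i iA; rewrite -sgn_None zxy// sgn_None xA.
  rewrite -xt; apply/ffunP => i; rewrite !ffunE.
  by case: ifP => // /zxy.
rewrite inE => /asboolP[x [/mem_vanish xZ xA xt]].
have xr : is_region Z (A :\ a)%SET t x.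
  by split => //; apply/mem_vanish => i iZ; rewrite xZ// !inE iZ orbT.
have xa : dot (u a) x = 0 by rewrite xZ// setU11.
have [y [yt ya]] := region_perturb true xr xa.
have [z [zt za]] := region_perturb false xr xa.
by rewrite inE (restrict_side yt ya) (restrict_side zt za).
Qed.

End Step.

Lemma card_regions Z A e : [disjoint Z & A]%B -> (#|Z| + e = d.+1)%N ->
  #|regions Z A| = region_number e #|A|.
Proof.
elim: {A}#|A| {-2}A (erefl #|A|) Z e => [|m IH] A Am Z e ZA Ze.
  rewrite Am; move/eqP: Am; rewrite cards_eq0 => /eqP ->.
  rewrite (_ : regions _ _ = [set [ffun=> None]])%SET ?cards1//.
  apply/setP => t; rewrite !inE; apply/asboolP/eqP.
    by move=> [x [_ _ <-]]; apply/ffunP => i; rewrite !ffunE inE.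
  move=> ->; exists 0; split; [exact: mem0v|by move=> i; rewrite inE|].
  by apply/ffunP => i; rewrite !ffunE inE.
have [a aA] : exists a, a \in A by apply/set0Pn; rewrite -cards_eq0 Am.
have Am' : #|(A :\ a)%SET| = m by rewrite (cardsD1 a) aA in Am; case: Am.
case: e Ze => [|e] Ze.
  rewrite Am/=; apply/eqP; rewrite cards_eq0 -finset.subset0; apply/fintype.subsetP => t.
  rewrite inE => /asboolP[x [xZ xA _]].
  have : vanish u Z == 0%VS by rewrite -dimv_eq0 dim_vanish// -Ze addn0 subnn.
  move=> /eqP V0; move: xZ; rewrite V0 memv0 => /eqP x0.
  by have := xA _ aA; rewrite x0 dot0r eqxx.
have aZ : a \notin Z by apply: contraTN aA => aZ; rewrite (disjointFr ZA).
rewrite (card_regions_step aA ZA); last by lia.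
rewrite Am/= -{2}Am' (IH _ Am' Z e.+1)//; last first.
  by apply: disjointWr ZA; exact: subD1set.
rewrite (IH _ Am' (a |: Z)%SET e) ?Am'//.
  rewrite disjoint_subset; apply/fintype.subsetP => i; rewrite !inE.
  by have [//|_ /= iZ] := eqVneq i a; rewrite (disjointFr ZA iZ).
by rewrite cardsU1 aZ; lia.
Qed.

Definition faces k : {set {ffun 'I_n -> option bool}} :=
  [set t | realized u t & #|zeros t| == (d - k)%N]%SET.

Lemma regionsC Z : regions Z (~: Z)%SET = [set t | realized u t & zeros t == Z]%SET.
Proof.
apply/setP => t; rewrite !inE; apply/asboolP/andP.
  move=> [x [/mem_vanish xZ xA <-]].
  have -> : restrict (~: Z)%SET (covector u x) = covector u x.
    apply/ffunP => i; rewrite !ffunE inE; case: ifPn => //; rewrite negbK => iZ.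
    by rewrite xZ// sgn0.
  split; first exact: realized_covector.
  apply/eqP/setP => i; rewrite in_zeros; apply/eqP/idP => [xi|/xZ//].
  by apply: contra_eqT xi => iZ; apply: xA; rewrite inE.
move=> [/asboolP[x <-] /eqP <-]; exists x; split.
- by apply/mem_vanish => i; rewrite in_zeros => /eqP.
- by move=> i; rewrite inE in_zeros.
apply/ffunP => i; rewrite ffunE inE; case: ifPn => //.
by rewrite negbK inE => /eqP.
Qed.

(** Faces are grouped by their zero set, of size [d - k]; each group is the set of regions of the
    remaining hyperplanes in a space of dimension [k.+1]. *)
Lemma card_faces k : (k <= d)%N -> (d - k <= n)%N ->
  #|faces k| = ('C(n, d - k) * cell_number (n + k - d) k)%N.
Proof.
move=> kd dkn; rewrite -sum1_card.
rewrite (partition_big (@zeros n) (fun Z => #|Z| == (d - k)%N)); last first.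
  by move=> t; rewrite inE => /andP[].
have -> : 'C(n, d - k) = #|[set Z : {set 'I_n} | #|Z| == (d - k)%N]%SET|.
  by rewrite card_draws card_ord.
rewrite -sum_nat_const; apply: eq_big => [Z|Z /eqP Zk]; first by rewrite inE.
rewrite sum1_card -region_number_cell.
transitivity #|regions Z (~: Z)%SET|.
  apply: eq_card => t; rewrite regionsC !inE unfold_in/= inE -andbA; congr andb.
  by apply: andb_idl => /eqP->; rewrite Zk.
rewrite (card_regions (e := k.+1)).
- by congr region_number; rewrite cardsCs finset.setCK Zk card_ord; lia.
- by rewrite -finset.setI_eq0 finset.setICr.
by rewrite Zk; lia.
Qed.

(** General position gives a vector with the signs of [t'] on the zeros of [t]; composing [t] with
    its covector yields [t']. *)
Lemma realized_above t t' : realized u t -> (#|zeros t| <= d.+1)%N ->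
  sle t t' -> realized u t'.
Proof.
move=> rt td /sleP tt'.
have [v hv] := gp (fun i => if t' i is Some b then (-1) ^+ (~~ b) else 0) td.
suff -> : t' = sign_comp t (covector u v) by apply: realized_comp => //; exact: realized_covector.
apply/ffunP => i; rewrite ffunE; case: ifPn => [ti|/tt'//].
rewrite ffunE hv ?inE//; case: (t' i) => [[]|]; rewrite /sgn ?eqxx//=.
  by rewrite expr0 oner_eq0 ltr01.
by rewrite expr1 oppr_eq0 oner_eq0 ltr0N1.
Qed.

End Count.

(** * Counting the sign vectors above a given one *)

Section Above.
Variable n : nat.
Implicit Types (t : {ffun 'I_n -> option bool}) (Z : {set 'I_n}).

Lemma card_above_zeros t Z : Z \subset zeros t ->
  #|[set t' | sle t t' & zeros t' == Z]%SET| = (2 ^ (#|zeros t| - #|Z|))%N.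
Proof.
move=> Zt.
(* The choices are independent over the entries: zero on [Z], either nonzero sign on the other zeros
   of [t], the sign of [t] elsewhere. *)
pose F i : pred (option bool) := if i \in Z then pred1 None
  else if i \in zeros t then predC1 None else pred1 (t i).
have -> : #|[set t' | sle t t' & zeros t' == Z]%SET| = #|family F|.
  apply: eq_card => t'; rewrite inE; apply/andP/familyP => [[/sleP h /eqP tZ] i|h].
    rewrite /F -tZ !inE; case: ifPn => // ti'; case: ifPn => // ti.
    by rewrite !inE h.
  split.
    apply/sleP => i ti; have := h i; rewrite /F.
    have it : i \notin zeros t by rewrite inE.
    rewrite ifN; last by apply: contra it => /(fintype.subsetP Zt).
    by rewrite (negbTE it) !inE => /eqP.
  apply/eqP/setP => i; have := h i; rewrite /F !inE.
  case: ifPn => [_|iZ]; first by rewrite inE => ->.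
  by case: ifPn => [_|/negbTE ti]; rewrite !inE; [move/negbTE|move/eqP->].
rewrite card_family foldrE big_map big_enum/=.
rewrite (bigID (fun i => i \in (zeros t :\: Z)%SET))/=.
rewrite [X in (_ * X)%N]big1 => [|i].
  rewrite muln1 (eq_bigr (fun=> 2%N)) => [|i].
    by rewrite prod_nat_const cardsD (finset.setIidPr Zt).
  rewrite /F inE => /andP[/negbTE -> ->].
  by rewrite cardC1 card_option card_bool.
rewrite /F inE negb_and negbK.
by case: ifP => /= _; rewrite ?card1// => /negbTE ->; rewrite card1.
Qed.

Lemma card_above t z :
  #|[set t' | sle t t' & #|zeros t'| == z]%SET| =
  ('C(#|zeros t|, z) * 2 ^ (#|zeros t| - z))%N.
Proof.
rewrite -sum1_card.
rewrite (partition_big (@zeros n) (fun Z => (Z \subset zeros t) && (#|Z| == z))); last first.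
  by move=> t'; rewrite inE => /andP[/sle_zeros -> ->].
rewrite -cards_draws -sum_nat_const; apply: eq_big => [Z|Z /andP[Zt /eqP Zz]]; first by rewrite inE.
rewrite sum1_card -Zz -card_above_zeros//; apply: eq_card => t'.
rewrite !inE unfold_in/= inE -andbA; congr andb.
by apply: andb_idl => /eqP->.
Qed.

End Above.

(** * Double counting of incidences between faces of two dimensions *)

Section Incidence.
Variables (R : realType) (d n : nat) (u : 'I_n -> 'rV[R]_d.+1).
Hypothesis gp : general_position u.

(** Exchanging the sums counts, for each [l]-face, the sign vectors above it with [d - k] zeros; by
    [realized_above] all of them are faces. *)
Lemma sum_faces_below k l : (l < k)%N -> (k <= d)%N ->
  (\sum_(t in faces u k) #|faces_below u l t| =
   #|faces u l| * ('C(d - l, d - k) * 2 ^ (k - l)))%N.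
Proof.
move=> lk kd.
under eq_bigr do rewrite -sum1_card.
rewrite (exchange_big_dep (mem (faces u l)))/=; last first.
  by move=> t t'; rewrite !inE => _ /and3P[-> _ ->].
rewrite -sum_nat_const; apply: eq_bigr => t; rewrite inE => /andP[rt /eqP tl].
have -> : (k - l = (d - l) - (d - k))%N by lia.
rewrite sum1_card -tl -card_above; apply: eq_card => t'.
rewrite !inE unfold_in /= !inE rt tl eqxx andbT /=.
case: (boolP (sle t t')) => [tt'|_]; last by rewrite andbF.
by rewrite (realized_above gp rt) ?andbT// tl; lia.
Qed.

Lemma cell_number_gt0 m j : (0 < cell_number m j)%N.
Proof.
rewrite /cell_number; case: ifP => // _.
by rewrite muln_gt0 /= big_ord_recl bin0.
Qed.

(** Both sides count nested subsets of sizes [c] and [b]. *)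
Lemma mul_bin_sub a b c : (c <= b)%N -> (b <= a)%N ->
  ('C(a, b) * 'C(b, c) = 'C(a, c) * 'C(a - c, b - c))%N.
Proof.
move=> cb ba; have ca := leq_trans cb ba.
have cb_ba : (b - c <= a - c)%N by exact: leq_sub2r.
have F m : (0 < m`!)%N by exact: fact_gt0.
apply/eqP; rewrite -(eqn_pmul2r (F (a - b)%N)) -(eqn_pmul2r (F c)).
rewrite -(eqn_pmul2r (F (b - c)%N)); apply/eqP.
have h1 := bin_fact ba; have h2 := bin_fact cb; have h3 := bin_fact ca.
have h4 := bin_fact cb_ba.
have e : (a - c - (b - c) = a - b)%N by lia.
rewrite e in h4.
transitivity (a`!); first by rewrite -h1 -h2; ring.
by rewrite -h3 -h4; ring.
Qed.

Lemma incidence_ratio k l : (l < k)%N -> (k <= d)%N -> (d - k <= n)%N ->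
  (\sum_(t in faces u k) #|faces_below u l t|)%:R / #|faces u k|%:R =
  (2 ^ (k - l) * 'C(n + k - d, k - l) * cell_number (n + l - d) l)%:R
     / (cell_number (n + k - d) k)%:R :> R.
Proof.
move=> lk kd dkn; rewrite sum_faces_below//.
have C0 : ('C(n, d - k) * cell_number (n + k - d) k)%N%:R != 0 :> R.
  by rewrite pnatr_eq0 -lt0n muln_gt0 bin_gt0 dkn cell_number_gt0.
have D0 : (cell_number (n + k - d) k)%:R != 0 :> R.
  by rewrite pnatr_eq0 -lt0n cell_number_gt0.
rewrite (card_faces gp kd dkn); apply/eqP; rewrite eqr_div// -!natrM; apply/eqP.
(* With fewer than [d - l] hyperplanes there are no [l]-faces, and the binomial coefficient on the
   other side vanishes as well. *)
congr (_%:R); have [dln|dln] := leqP (d - l) n; last first.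
  rewrite [X in (X * _)%N](_ : _ = 0)%N; last first.
    apply/eqP; rewrite muln_eq0 cards_eq0; apply/orP; left.
    rewrite -finset.subset0; apply/fintype.subsetP => t; rewrite inE => /andP[_ /eqP tl].
    by have := max_card (mem (zeros t)); rewrite card_ord tl leqNgt dln.
  by rewrite (@bin_small (n + k - d)) ?muln0 ?mul0n//; lia.
rewrite (card_faces gp _ dln); last by lia.
have e1 : (k - l = d - l - (d - k))%N by lia.
have e2 : (n + k - d = n - (d - k))%N by lia.
have := @mul_bin_sub n (d - l) (d - k) _ dln; rewrite -e1 -e2 => h.
transitivity (('C(n, d - l) * 'C(d - l, d - k)) * cell_number (n + l - d) l *
  2 ^ (k - l) * cell_number (n + k - d) k)%N; first by ring.
by rewrite h; [ring|lia].
Qed.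

End Incidence.
(** * Cells of the tessellation *)

Section Cells.
Variables (R : realType) (d : nat).
Implicit Types (x y v : 'rV[R]_d.+1).

Lemma continuous_dot a : continuous (@dot R d a).
Proof.
move=> x; rewrite /continuous_at /dot.
apply: (cvg_big (@add_continuous _) (F := nbhs x)) => i _.
by apply: cvgMl_tmp; exact: coord_continuous.
Qed.

Lemma continuous_dot_self : continuous (fun x => dot x x).
Proof.
move=> x; rewrite /continuous_at /dot.
apply: (cvg_big (@add_continuous _) (F := nbhs x)) => i _.
by apply: cvgM; exact: coord_continuous.
Qed.

Lemma closed_sphere : closed (sphere R d).
Proof.
apply: (@preimage_closed _ _ (fun x => dot x x) [set 1]).
  by move=> x _; exact: continuous_dot_self.
exact: closed_eq.
Qed.

Lemma closed_polyhedral_cone C : @polyhedral_cone R d C -> closed C.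
Proof.
move=> [m [a ->]].
rewrite (_ : mkset _ = \bigcap_(i in setT) (dot (a i) @^-1` [set r | r <= 0])).
  apply: closed_bigI => i _; apply: preimage_closed; last exact: closed_le.
  by move=> x _; exact: continuous_dot.
by apply/seteqP; split => x /= h i; [move=> _|]; exact: h.
Qed.

(** The great-circle arc from [y] at 0 to [x] at 1, as a projected chord; for points of the sphere
    the chord misses the origin unless they are antipodal. *)
Definition arc x y (t : R) := normalize ((1 - t) *: y + t *: x).

Lemma segment_neq0 x y t : sphere R d x -> sphere R d y -> y != - x ->
  0 <= t <= 1 -> (1 - t) *: y + t *: x != 0.
Proof.
move=> xS yS yx /andP[t0 t1]; apply: contraNneq yx => /eqP.
rewrite addr_eq0 => /eqP e.
have : dot ((1 - t) *: y) ((1 - t) *: y) = dot (- (t *: x)) (- (t *: x)) by rewrite e.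
rewrite dotNl dotNr opprK !dotZl !dotZr xS yS !mulr1 => tt.
(* Equal norms force equal coefficients, and then [y = - x]. *)
have t2 : 1 - t = t by nra.
have t_gt0 : t != 0 by apply/eqP => t00; lra.
by move: e; rewrite t2 -scalerN => /(scalerI t_gt0) ->.
Qed.

Lemma continuous_arc x y t : (1 - t) *: y + t *: x != 0 ->
  {for t, continuous (arc x y)}.
Proof.
move=> h0.
pose g := fun t : R => (1 - t) *: y + t *: x.
have cg : {for t, continuous g}.
  apply: cvgD; apply: cvgZr_tmp => //; apply: cvgB; [exact: cvg_cst|exact: cvg_id].
have cn : {for g t, continuous (@normalize R d)}.
  apply: (@continuousZ _ _ _ (fun x => (Num.sqrt (dot x x))^-1) id); last exact: cvg_id.
  apply: (@continuousV _ _ (fun x => Num.sqrt (dot x x))).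
    by rewrite gt_eqF// sqrtr_gt0 dot_gt0.
  apply: (@continuous_comp _ _ _ (fun x => dot x x) (@Num.sqrt R)).
    exact: continuous_dot_self.
  exact: sqrt_continuous.
exact: continuous_comp cg cn.
Qed.

Lemma arc0 x y : sphere R d y -> arc x y 0 = y.
Proof. by move=> yS; rewrite /arc subr0 scale1r scale0r addr0 normalize_id. Qed.

Lemma arc1 x y : sphere R d x -> arc x y 1 = x.
Proof. by move=> xS; rewrite /arc subrr scale1r scale0r add0r normalize_id. Qed.

Lemma arc_component (A : set 'rV[R]_d.+1) x y :
  sphere R d x -> sphere R d y -> y != - x ->
  (forall t, 0 <= t <= 1 -> A (arc x y t)) -> connected_component A x y.
Proof.
move=> xS yS yx h.
exists (arc x y @` `[0, 1]%classic); last by exists 0; rewrite ?arc0//= in_itv/= lexx ler01.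
split.
- by exists 1; rewrite ?arc1//= in_itv/= lexx ler01.
- by move=> z [t /=]; rewrite in_itv/= => t01 <-; exact: h.
apply: connected_continuous_connected; first exact: segment_connected.
apply: continuous_in_subspaceT => t; rewrite inE/= in_itv/= => t01.
by apply: continuous_arc; exact: segment_neq0.
Qed.

(** Serves to join antipodal points by two arcs when there is no hyperplane. If the first basis
    vector is [x] or [- x], the last one works, being different from it as [1 <= d]. *)
Lemma sphere_neq_opp x : (1 <= d)%N -> exists2 z, sphere R d z & z != x /\ z != - x.
Proof.
move=> d1.
pose e (i : 'I_d.+1) : 'rV[R]_d.+1 := delta_mx ord0 i.
have dote i v : dot (e i) v = v ord0 i.
  rewrite /dot (bigD1 i)//= mxE !eqxx mul1r big1 ?addr0// => j ji.
  by rewrite mxE eqxx/= (negbTE ji) mul0r.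
have eS i : sphere R d (e i) by rewrite /sphere/= dote mxE !eqxx.
have m0 : (@ord_max d) != ord0 by rewrite -val_eqE/= -lt0n.
have [/andP[h1 h2]|] := boolP ((e ord0 != x) && (e ord0 != - x)).
  by exists (e ord0).
rewrite negb_and !negbK => h; exists (e ord_max); first exact: eS.
have : x ord0 ord_max = 0.
  case/orP: h => /eqP; first by move=> <-; rewrite mxE eqxx/= (negbTE m0).
  move/(congr1 (fun v : 'rV_d.+1 => v ord0 ord_max)); rewrite !mxE (negbTE m0)/= => /esym/eqP.
  by rewrite oppr_eq0 => /eqP.
move=> x0; split; apply/eqP => /(congr1 (fun v : 'rV_d.+1 => v ord0 ord_max)).
  by rewrite x0 mxE !eqxx => /eqP; rewrite oner_eq0.
by rewrite !mxE x0 !eqxx oppr0 => /eqP; rewrite oner_eq0.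
Qed.

Variables (n : nat) (u : 'I_n -> 'rV[R]_d.+1).
Hypothesis d1 : (1 <= d)%N.

Let A := sphere R d `\` \bigcup_i perp (u i).

Lemma complementE x : A x <-> sphere R d x /\ zeros (covector u x) = finset.set0.
Proof.
split=> [[xS xu]|[xS x0]].
  split=> //; apply/setP => i; rewrite in_zeros inE; apply/negP => /eqP xi.
  by apply: xu; exists i => //; split.
split=> // -[i _ [_ /= xi]]; have : i \in zeros (covector u x).
  by rewrite in_zeros xi.
by rewrite x0 inE.
Qed.

Lemma covector_segment x y (s t : R) : sle (covector u y) (covector u x) ->
  0 <= s -> 0 < t -> covector u (s *: y + t *: x) = covector u x.
Proof.
move=> /sleP h s0 t0; apply/ffunP => i; have := h i.
rewrite !ffunE sgn_None dotDr !dotZr.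
have [->|yi] := eqVneq (dot (u i) y) 0; first by rewrite mulr0 add0r sgn_pos.
move=> /(_ isT) e; move: s0; rewrite le_eqVlt => /predU1P[<-|s0].
  by rewrite mul0r add0r sgn_pos.
by rewrite sgn_comb.
Qed.

Lemma covector_arc x y t : sphere R d x -> sphere R d y -> y != - x ->
  sle (covector u y) (covector u x) -> 0 < t <= 1 ->
  covector u (arc x y t) = covector u x.
Proof.
move=> xS yS yx h /andP[t0 t1]; rewrite /arc covectorZ; last first.
  by apply/normalize_gt0/segment_neq0 => //; rewrite ltW.
by apply: covector_segment => //; rewrite subr_ge0.
Qed.

Lemma sphere_arc x y t : sphere R d x -> sphere R d y -> y != - x ->
  0 <= t <= 1 -> sphere R d (arc x y t).
Proof. by move=> *; apply/sphere_normalize/segment_neq0. Qed.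

Lemma cone_neq_opp x y : (0 < n)%N -> A x -> sle (covector u y) (covector u x) -> y != - x.
Proof.
move=> n0 /complementE[_ /setP x0] yx; apply/eqP => e.
pose i := Ordinal n0; have := x0 i; rewrite in_zeros inE => xi.
move/sleP: yx => /(_ i); rewrite !ffunE e dotNr sgn_None oppr_eq0 xi => /(_ isT).
rewrite /sgn oppr_eq0 xi oppr_gt0 => -[]; move/negbT: xi.
by case: (ltgtP 0 (dot (u i) x)).
Qed.

Definition open_cell x := [set y | sphere R d y /\ covector u y = covector u x].

(** On a connected part of the complement each [dot (u i)] has values in an interval omitting 0, so
    its sign is constant. Conversely, points with equal signs are joined by arcs along which the
    signs do not change. *)
Lemma open_cell_component x : A x -> connected_component A x = open_cell x.
Proof.
move=> Ax; apply/seteqP; split=> y.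
  move=> [C [Cx CA cC Cy]].
  have [yS y0] := (complementE y).1 (CA _ Cy); split => //.
  apply/ffunP => i; rewrite !ffunE.
  have : connected (dot (u i) @` C).
    apply: connected_continuous_connected => //; apply: continuous_subspaceT.
    exact: continuous_dot.
  move/connected_intervalP => itv.
  have n0 z : C z -> dot (u i) z != 0.
    by move=> Cz; have [_ /setP/(_ i)] := (complementE z).1 (CA _ Cz); rewrite in_zeros inE => ->.
  have key z w : C z -> C w -> dot (u i) z < 0 -> ~~ (0 < dot (u i) w).
    move=> Cz Cw z0; apply/negP => w0.
    have zI : (dot (u i) @` C) (dot (u i) z) by exists z.
    have wI : (dot (u i) @` C) (dot (u i) w) by exists w.
    have [|v Cv v0] := itv _ _ zI wI 0; first by rewrite !ltW.
    by have := n0 _ Cv; rewrite v0 eqxx.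
  have := key _ _ Cx Cy; have := key _ _ Cy Cx; have := n0 _ Cx; have := n0 _ Cy.
  rewrite /sgn; case: (ltgtP 0 (dot (u i) x)) => //; case: (ltgtP 0 (dot (u i) y)) => //.
    by move=> _ _ _ _ /(_ isT).
  by move=> _ _ _ _ _ /(_ isT).
move=> [yS yx]; have [xS x0] := (complementE x).1 Ax.
have opp x' y' : A x' -> sphere R d y' -> covector u y' = covector u x' -> y' != - x' ->
    connected_component A x' y'.
  move=> Ax' yS' yx' y'x'; have [xS' x0'] := (complementE x').1 Ax'.
  apply: arc_component => // t /andP[]; rewrite le_eqVlt => /predU1P[<- _|t0 t1].
    by rewrite arc0//; apply/complementE; rewrite yx'.
  apply/complementE; split; first by apply: sphere_arc; rewrite ?(ltW t0).
  by rewrite covector_arc ?t0// yx' sle_refl.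
have [n0|n0] := posnP n; last first.
  by apply: opp => //; apply: cone_neq_opp => //; rewrite yx sle_refl.
have triv (t t' : {ffun 'I_n -> option bool}) : t = t'.
  by apply/ffunP => i; have := ltn_ord i; rewrite {2}n0.
have [z zS [zx zNx]] := sphere_neq_opp x d1.
have Az : A z by apply/complementE; split => //; rewrite (triv (covector u z) (covector u x)).
have [e|yx'] := eqVneq y (- x); last exact: opp.
apply: (@connected_component_trans _ _ z); first by apply: opp.
apply: opp => //; rewrite e; apply: contra_neq zx => /eqP.
by rewrite eqr_opp => /eqP.
Qed.

(** The right side is closed. Conversely, the arc from a point [y] of it towards [x] enters the open
    cell at once; for [n = 0], [y] is itself in the open cell. *)
Lemma closure_open_cell x : A x -> closure (open_cell x) = sph_cone u (covector u x).
Proof.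
move=> Ax; have [xS x0] := (complementE x).1 Ax.
apply/seteqP; split.
  have : closed (sph_cone u (covector u x)).
    apply: closedI; last exact: closed_sphere.
    by apply: (@closed_polyhedral_cone (cone u _)); exact: polyhedral_cone_cone.
  move=> /closure_id ->; apply: closureS => y [yS yx]; split => //.
  by rewrite /cone/= yx; exact: sle_refl.
move=> y [yx yS] B.
have [n0|n0] := posnP n.
  move=> /nbhs_singleton By; exists y; split => //; split => //.
  by apply/ffunP => i; have := ltn_ord i; rewrite {2}n0.
have y_x := cone_neq_opp n0 Ax yx.
rewrite -{1}(arc0 x yS) => yB.
have : nbhs (0 : R) (arc x y @^-1` B).
  by apply: continuous_arc yB; apply: segment_neq0; rewrite // lexx ler01.
move=> /nbhs_ballP[e /= e0 eB].
pose t := Num.min (e / 2) 1.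
have t0 : 0 < t by rewrite lt_min ltr01 divr_gt0.
have te : t < e by rewrite gt_min; apply/orP; left; rewrite ltr_pdivrMr// ltr_pMr// ltr1n.
have t1 : t <= 1 by rewrite ge_min lexx orbT.
exists (arc x y t); split.
  split; first by apply: sphere_arc; rewrite ?(ltW t0).
  by apply: covector_arc; rewrite ?t0.
by apply: eB; rewrite /ball/= sub0r normrN gtr0_norm.
Qed.

Lemma tess_cellsE : tess_cells (fun i => perp (u i)) =
  [set sph_cone u (covector u x) | x in A].
Proof.
rewrite /tess_cells -/A; apply/seteqP; split => _ [x Ax <-]; exists x => //.
  by rewrite open_cell_component// closure_open_cell.
by rewrite open_cell_component// closure_open_cell.
Qed.

Hypothesis gp : general_position u.

(** Cells are the sign vectors without zeros. Every face lies below one: compose it with the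
    covector of a [v] that is positive on all its zeros. *)
Lemma tess_facesE k : (k <= d)%N ->
  tess_faces k (fun i => perp (u i)) = sph_cone u @` [set` faces u k].
Proof.
move=> kd; rewrite /tess_faces tess_cellsE bigcup_image.
apply/seteqP; split => Q.
  move=> [x /complementE[xS x0]].
  rewrite sph_faces_cone//; first last.
  - by rewrite x0 cards0.
  - exact: realized_covector.
  move=> [t /=]; rewrite inE => /and3P[rt _ zt] <-.
  by exists t => //=; rewrite inE rt.
move=> [t /=]; rewrite inE => /andP[rt zt] <-.
have zd : (#|zeros t| <= d.+1)%N by rewrite (eqP zt); lia.
have [v hv] := gp (fun=> 1) zd.
pose s := sign_comp t (covector u v).
have s0 : zeros s = finset.set0.
  apply/setP => i; rewrite !inE ffunE; case: ifPn => [ti|/negbTE//].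
  by rewrite ffunE hv ?inE// sgn_None oner_eq0.
have rs : realized u s by apply: realized_comp => //; exact: realized_covector.
have [|x xS xs] := realized_sphere gp rs; first by rewrite s0 cards0.
exists x; first by apply/complementE; rewrite xs.
rewrite xs sph_faces_cone ?s0 ?cards0//.
by exists t => //=; rewrite inE rt zt sle_comp.
Qed.

End Cells.
Lemma uniform_mean_general_position (R : realType) (d n k l : nat)
    (u : 'I_n -> 'rV[R]_d.+1) :
  (1 <= d)%N -> (k <= d)%N -> (l < k)%N -> (d - k <= n)%N ->
  general_position u ->
  uniform_mean (tess_faces k (fun i => perp (u i)))
    (fun F => (face_number l F)%:R) =
  (2 ^ (k - l) * 'C(n + k - d, k - l) * cell_number (n + l - d) l)%:R
     / (cell_number (n + k - d) k)%:R :> R.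
Proof.
move=> d1 kd lk dkn gp; rewrite -(incidence_ratio gp lk kd dkn).
have inj : {in faces u k &, injective (sph_cone u)}.
  by move=> t t'; rewrite !inE => /andP[rt _] /andP[rt' _]; exact: sph_cone_inj.
rewrite /uniform_mean tess_facesE// card_fset_set_image//.
rewrite fsbig_finite/=; last exact: finite_image.
rewrite (perm_big _ (perm_fset_set_image inj))/= big_map big_enum/= natr_sum.
congr (_ / _); apply: eq_bigr => t; rewrite inE => /andP[rt /eqP zt].
by rewrite face_number_cone//; rewrite ?zt; lia.
Qed.
(** * Expectations and independence *)

Section Expectation.
Context {disp : measure_display} {Omega : measurableType disp} {R : realType}.
Variable P : probability Omega R.

(** The integral of a nonnegative function is a supremum over the simple functions below it, hence
    monotone without measurability. *)
Lemma nonmeasurable_le_integral (f g : Omega -> \bar R) :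
  (forall w, 0 <= f w)%E -> (forall w, f w <= g w)%E ->
  (\int[P]_w f w <= \int[P]_w g w)%E.
Proof.
move=> f0 fg; have g0 w : (0 <= g w)%E by apply: le_trans (fg w).
rewrite !ge0_integralTE//; apply: le_ereal_sup => _ [h hf <-].
by exists h => // w; apply: le_trans (fg w).
Qed.

(* The typical-face statistic is not known to be measurable, so it is squeezed
   between two functions that are. *)
Lemma expectation_negligible_cst (f : Omega -> R) (c : R) (N : set Omega) :
  (forall w, 0 <= f w) -> 0 <= c -> P.-negligible N ->
  (forall w, ~ N w -> f w = c) -> ('E_P[f] = c%:E)%E.
Proof.
move=> f0 c0 [A [mA PA NA]] fc.
have fA w : ~ A w -> f w = c by move=> Aw; apply: fc => /NA.
have intc : (\int[P]_w cst c%:E w = c%:E)%E.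
  by rewrite integral_cst//= probability_setT mule1.
have mA' : measurable_fun setT (fun w => w \in A).
  by apply: (measurable_fun_bool true); rewrite setTI preimage_mem_true.
have ae (a : \bar R) : (0 <= a)%E ->
    (\int[P]_w (if w \in A then a else c%:E) = c%:E)%E.
  move=> a0; rewrite -[RHS]intc; apply: ge0_ae_eq_integral => //.
  - by apply: measurable_fun_ifT => //; exact: measurable_cst.
  - by move=> w _; case: ifP.
  exists A; split => // w /= h; apply: contrapT => Aw; apply: h => _.
  by rewrite memNset.
rewrite unlock; apply/le_anti/andP; split.
  rewrite -(ae +oo%E)//; apply: nonmeasurable_le_integral => w.
    by rewrite lee_fin.
  by case: ifPn => [_|]; [rewrite leey|rewrite notin_setE => /fA ->].
rewrite -(ae 0%E)//; apply: nonmeasurable_le_integral => w; first by case: ifP.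
by case: ifPn => [_|]; [rewrite lee_fin|rewrite notin_setE => /fA ->].
Qed.

End Expectation.

(** * Null events of independent pairs, and one variable against all the others *)

Section Independence.
Context {disp : measure_display} {Omega : measurableType disp} {R : realType}.
Variable P : probability Omega R.

Section Pair.
Context d1 d2 {T1 : measurableType d1} {T2 : measurableType d2}.
Variables (U : {RV P >-> T1}) (V : {RV P >-> T2}).

Definition pairRV w := (U w, V w).

Let measurable_pairRV : measurable_fun setT pairRV.
Proof. by apply: measurable_fun_pair; exact: measurable_funPT. Qed.

HB.instance Definition _ :=
  isMeasurableFun.Build _ _ _ _ pairRV measurable_pairRV.

(** By independence the law of the pair is the product measure, which integrates the null sections
    to 0. *)
Lemma independent_negligible (D : set (T1 * T2)) :
  (forall A B, measurable A -> measurable B ->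
    P (U @^-1` A `&` V @^-1` B) = P (U @^-1` A) * P (V @^-1` B))%E ->
  measurable D ->
  (forall x, P (V @^-1` xsection D x) = 0%E) ->
  P.-negligible [set w | D (U w, V w)].
Proof.
move=> ind mD D0; exists (pairRV @^-1` D); split => //.
  by rewrite -[X in measurable X]setTI; exact: measurable_pairRV.
rewrite -[LHS]/(distribution P pairRV D).
rewrite -(@product_measure_unique _ _ _ _ _ (distribution P U) (distribution P V))//.
rewrite /product_measure1; apply: integral0_eq => x _ /=.
exact: D0.
Qed.

End Pair.
End Independence.
Section Subfamily.
Context {disp disp' : measure_display} {Omega : measurableType disp}.
Context {E : measurableType disp'} {R : realType} {P : probability Omega R}.
Variables (n : nat) (X : 'I_n -> {RV P >-> E}) (a : 'I_n).
Hypothesis ind : mutually_independent X.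

(** A pi-system generating the sigma-algebra of the variables other than [X a], whose factor is
    removed by [B a = setT]. *)
Definition others : set (set Omega) :=
  [set A | exists B : 'I_n -> set E, [/\ forall i, measurable (B i), B a = setT &
    A = \bigcap_i (X i @^-1` B i)]].

Lemma measurable_preimage_RV d' (T' : measurableType d') (Y : {RV P >-> T'}) B :
  measurable B -> measurable (Y @^-1` B).
Proof. by move=> mB; rewrite -[X in measurable X]setTI; exact: measurable_funPT. Qed.

Lemma measurable_others A : others A -> measurable A.
Proof.
move=> [B [mB _ ->]]; apply: fin_bigcap_measurable; first exact: finite_finset.
by move=> i _; exact: measurable_preimage_RV.
Qed.

Lemma others_setI : setI_closed others.
Proof.
move=> _ _ [B [mB Ba ->]] [C [mC Ca ->]]; exists (fun i => B i `&` C i); split.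
- by move=> i; exact: measurableI.
- by rewrite Ba Ca setIT.
by rewrite -bigcapI.
Qed.

Lemma othersT : others setT.
Proof.
exists (fun=> setT); split => //.
by apply/seteqP; split => // w _ i _.
Qed.

Lemma others_preimage i B : i != a -> measurable B -> others (X i @^-1` B).
Proof.
move=> ia mB; exists (fun j => if j == i then B else setT); split.
- by move=> j; case: ifP.
- by rewrite eq_sym (negbTE ia).
apply/seteqP; split => w; last by move=> /(_ i I); rewrite /= eqxx.
by move=> Bw j _ /=; case: eqVneq => [->|].
Qed.

(** Both sides are finite measures in [A] that agree on the pi-system [others], hence on the
    sigma-algebra it generates. *)
Lemma independent_others A C : <<s others >> A -> measurable C ->
  (P (A `&` X a @^-1` C) = P A * P (X a @^-1` C))%E.
Proof.
move=> sA mC; have mXC := measurable_preimage_RV (X a) mC.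
have r0 : 0 <= fine (P (X a @^-1` C)) by apply: fine_ge0.
transitivity (mscale (NngNum r0) P A); last first.
  by rewrite /mscale/= fineK ?fin_num_measure// muleC.
rewrite -[LHS]/(mrestr P mXC A).
apply: (g_sigma_algebra_measure_unique others _ (fun=> setT)) => //.
- exact: measurable_others.
- by move=> _; exact: othersT.
- by rewrite bigcup_const.
- exact: others_setI.
- move=> _ [B [mB Ba ->]].
  rewrite -[LHS]/(P (_ `&` X a @^-1` C)) -[RHS]/((fine (P (X a @^-1` C)))%:E * P _)%E.
  rewrite fineK ?fin_num_measure// muleC.
  pose B' i := if i == a then C else B i.
  have mB' i : measurable (B' i) by rewrite /B'; case: ifP.
  have -> : (\bigcap_i (X i @^-1` B i)) `&` X a @^-1` C = \bigcap_i (X i @^-1` B' i).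
    apply/seteqP; split => w.
      by move=> [wB wC] i _; rewrite /B'; case: eqVneq => [->|_] //=; exact: wB.
    move=> wB'; split; last by have := wB' a I; rewrite /B' eqxx.
    move=> i _ /=; have := wB' i I; rewrite /B'; case: eqVneq => [->|] //=.
    by rewrite Ba.
  rewrite !ind// (bigD1 a)//= [in RHS](bigD1 a)//= /B' eqxx Ba preimage_setT.
  rewrite probability_setT mul1e muleC; congr (_ * _)%E.
  by apply: eq_bigr => i /negbTE ->.
move=> _; rewrite -[X in (X < _)%E]/(P (_ `&` X a @^-1` C)) setTI.
by apply: (le_lt_trans (probability_le1 _ _)) => //; exact: ltry.
Qed.

(** The identity onto [Omega] with a coarser sigma-algebra: one random variable carrying all the
    others, to be paired with [X a]. *)
Definition othersRV : Omega -> g_sigma_algebraType others := id.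

Let measurable_othersRV : measurable_fun setT othersRV.
Proof.
move=> _ B mB; rewrite setTI; apply: (smallest_sub _ measurable_others) mB.
exact: sigma_algebra_measurable.
Qed.

HB.instance Definition _ :=
  isMeasurableFun.Build _ _ _ _ othersRV measurable_othersRV.

Lemma measurable_fun_others i : i != a ->
  measurable_fun setT (X i : g_sigma_algebraType others -> E).
Proof.
move=> ia _ B mB; rewrite setTI; apply: sub_sigma_algebra.
exact: others_preimage.
Qed.

End Subfamily.

(** * Measurability of determinants, inverses and continuous functions *)

Section MeasurableCoordinates.
Variable R : realType.

Lemma measurable_det disp (T : measurableType disp) m (M : T -> 'M[R]_m) :
  (forall i j, measurable_fun setT (fun w => M w i j)) ->
  measurable_fun setT (fun w => \det (M w)).
Proof.
move=> mM; apply: measurable_sum => s; apply: measurable_funM => //.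
by apply: measurable_prod => i _; exact: mM.
Qed.

Lemma measurable_inv : measurable_fun setT (@GRing.inv R).
Proof.
have -> : @GRing.inv R = fun r => if r == 0 then 0 else r^-1.
  by apply/funext => r; case: eqVneq => // ->; rewrite invr0.
apply: measurable_fun_if => //.
  by apply: measurable_fun_eqr => //; exact: measurable_id.
rewrite setTI; apply: open_continuous_measurable_fun.
  rewrite (_ : _ @^-1` _ = ~` [set 0]); first exact/closed_openC/closed_eq.
  by apply/seteqP; split => r /= => [/eqP|] r0; [exact/eqP/negbT/eqP|exact/negbTE/eqP].
move=> r; rewrite inE /= => /negbT r0; exact: inv_continuous.
Qed.

Lemma closed_measurable_borelE d (A : set 'rV[R]_d.+1) : closed A ->
  measurable (A : set (borelE R d)).
Proof.
move=> cA; rewrite -[A]setCK; apply: measurableC; apply: sub_sigma_algebra.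
exact: closed_openC.
Qed.

Lemma continuous_measurable_borelE d (f : 'rV[R]_d.+1 -> R) : continuous f ->
  measurable_fun setT (f : borelE R d -> R).
Proof.
move=> /continuousP cf; apply: (measurability _ (RGenOpens.measurableE R)).
move=> _ [_ [a [b ->] <-]]; rewrite setTI; apply: sub_sigma_algebra.
exact/cf/interval_open.
Qed.

End MeasurableCoordinates.
(** * Almost sure general position *)

Section Representative.
Variables (R : realType) (d : nat).
Implicit Types u v x y b : 'rV[R]_d.+1.

Lemma perpZ (c : R) u : c != 0 -> perp (c *: u) = perp u.
Proof.
move=> c0; apply/seteqP; split => x [xS /= ux]; split => //=.
  by apply/eqP; rewrite -(mulrI_eq0 _ (lregP c0)) -dotZl ux.
by rewrite dotZl ux mulr0.
Qed.

(** If nonzero, the part [w] of [v] orthogonal to [u] would, once normalized, lie in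
    [perp u = perp v], hence be orthogonal to itself. *)
Lemma perp_inj u v : u != 0 -> perp u = perp v -> exists2 c, c != 0 & v = c *: u.
Proof.
move=> u0 uv.
pose c := dot u v / dot u u; pose w := v - c *: u.
have uu : dot u u != 0 by rewrite dot_eq0.
have uw : dot u w = 0 by rewrite /w dotBr dotZr /c divfK// subrr.
have w0 : w = 0.
  apply/eqP/negPn/negP => w0.
  have : perp u (normalize w).
    by split; [exact: sphere_normalize|rewrite /= dotZr uw mulr0].
  rewrite uv => -[_ /= /eqP]; rewrite dotZr mulf_eq0 gt_eqF ?normalize_gt0//= => /eqP vw.
  have /eqP := dot_eq0 w; rewrite (negbTE w0) => /eqP/negP; apply.
  by rewrite {1}/w dotDl vw dotNl dotZl uw mulr0 subr0.
have vE : v = c *: u by apply/eqP; rewrite -subr_eq0 -/w w0.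
exists c => //; apply: contra_neq u0 => c0.
have v0 : v = 0 by rewrite vE c0 scale0r.
apply/eqP/negPn/negP => u0; have := sphere_normalize u0 => uS.
have : perp v (normalize u) by split => //=; rewrite v0 dot0l.
by rewrite -uv => -[_ /= /eqP]; rewrite dotZr mulf_eq0 (negbTE uu) orbF gt_eqF ?normalize_gt0.
Qed.

(* The representative with first coordinate [1], or [0] when that coordinate
   vanishes (as [0^-1 = 0]). *)
Definition rep (A : set 'rV[R]_d.+1) : 'rV[R]_d.+1 :=
  let u := xget 0 [set u | perp u = A] in (u ord0 ord0)^-1 *: u.

(** The choice made by [xget] is harmless: nonzero vectors with the same [perp] are proportional,
    and the factor cancels in the quotient. *)
Lemma rep_perp u : rep (perp u) = (u ord0 ord0)^-1 *: u.
Proof.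
rewrite /rep; set v := xget _ _.
have vu : perp v = perp u by rewrite /v; apply: (@xgetI _ 0 [set v | perp v = perp u] u).
have [v0|v0] := eqVneq v 0.
  have [->|u0] := eqVneq u 0; first by rewrite v0.
  have [c c0 vE] := perp_inj u0 (esym vu).
  by move/eqP: v0; rewrite vE scaler_eq0 (negbTE c0) (negbTE u0).
have [c c0 ->] := perp_inj v0 vu.
by rewrite mxE invfM scalerA -mulrA mulrCA mulVf ?mulr1.
Qed.

Lemma measurable_coord j :
  measurable_fun setT ((fun u => u ord0 j) : borelE R d -> R).
Proof. by apply: continuous_measurable_borelE; exact: coord_continuous. Qed.

(** The sigma-algebra on hyperspheres tests measurability after composition with [perp], where [rep]
    becomes a quotient of coordinates. *)
Lemma measurable_rep j :
  measurable_fun setT ((fun A => rep A ord0 j) : hypersphere_space R d -> R).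
Proof.
move=> _ Y mY; rewrite setTI; apply: sub_sigma_algebra.
rewrite /image_set_system /= setTI.
rewrite (_ : _ @^-1` _ = (fun u : borelE R d => (u ord0 ord0)^-1 * u ord0 j) @^-1` Y).
  rewrite -[X in measurable X]setTI.
  have : measurable_fun setT (fun u : borelE R d => (u ord0 ord0)^-1 * u ord0 j).
    apply: measurable_funM; last exact: measurable_coord.
    apply: measurableT_comp; first exact: measurable_inv.
    exact: measurable_coord.
  by apply.
by apply/seteqP; split => u /=; rewrite rep_perp mxE.
Qed.

Definition chart : set (hypersphere_space R d) :=
  [set perp u | u in [set u : 'rV[R]_d.+1 | u ord0 ord0 != 0]].

Lemma perp_chart :
  (@perp R d : borelE R d -> hypersphere_space R d) @^-1` chart = [set u | u ord0 ord0 != 0].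
Proof.
apply/seteqP; split => u; last by exists u.
move=> [v /= v0 vu]; have : rep (perp u) ord0 ord0 = rep (perp v) ord0 ord0 by rewrite -vu.
rewrite !rep_perp !mxE (mulVf v0) => e; apply/eqP => u0.
by move: e; rewrite u0 mulr0 => /esym/eqP; rewrite oner_eq0.
Qed.

Lemma chart_perp A : chart A -> perp (rep A) = A.
Proof. by move=> [u u0 <-]; rewrite rep_perp perpZ// invr_eq0. Qed.

Lemma measurable_coord_neq0 :
  measurable ([set u | u ord0 ord0 != 0] : set (borelE R d)).
Proof.
have := measurable_coord ord0 measurableT (measurableC (measurable_set1 (0 : R))).
rewrite setTI; congr (measurable _); apply/seteqP.
by split => u /= /eqP.
Qed.

Lemma measurable_chart : measurable chart.
Proof.
apply: sub_sigma_algebra; rewrite /image_set_system /= setTI perp_chart.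
exact: measurable_coord_neq0.
Qed.

Lemma perp_great_hypersphere b : b != 0 -> is_great_hypersphere (perp b).
Proof.
move=> b0; pose u (i : 'I_1) := b.
have gp : general_position u.
  move=> Z c _; exists ((c ord0 / dot b b) *: b) => i _.
  by rewrite dotZr divfK ?dot_eq0// (ord1 i).
exists (vanish u [set: 'I_1]%SET); first by rewrite dim_vanish// cardsT card_ord subn1.
apply/seteqP; split => x [xS /= xb]; split => //=.
  by apply/mem_vanish.
by move/mem_vanish: xb => /(_ ord0); rewrite inE; apply.
Qed.

Variable kappa0 : probability (borelE R d) R.
Hypothesis kappa0_even : even_sphere_distribution kappa0.
Hypothesis kappa0_nd : nondegenerate_distribution kappa0.

Lemma negligible_hyperplane b : b != 0 ->
  kappa0.-negligible ([set u | dot b u = 0] : set (borelE R d)).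
Proof.
move=> b0.
have mS : measurable (sphere R d : set (borelE R d)).
  by apply: closed_measurable_borelE; exact: closed_sphere.
have mp : measurable (perp b : set (borelE R d)).
  apply: closed_measurable_borelE; apply: closedI; first exact: closed_sphere.
  apply: (@preimage_closed _ _ (dot b) [set 0]); last exact: closed_eq.
  by move=> x _; exact: continuous_dot.
exists (perp b `|` ~` sphere R d); split.
- by apply: measurableU => //; exact: measurableC.
- rewrite measureU0//; first exact/kappa0_nd/perp_great_hypersphere.
    exact: measurableC.
  by have := probability_setC kappa0 mS; rewrite kappa0_even.1 subee.
move=> u /= bu; have [uS|uS] := pselect (sphere R d u); first by left.
by right.
Qed.

Lemma coord_dot u : u ord0 ord0 = dot (delta_mx ord0 ord0) u.
Proof.
rewrite /dot (bigD1 ord0)//= mxE !eqxx mul1r big1 ?addr0// => j j0.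
by rewrite mxE eqxx/= (negbTE j0) mul0r.
Qed.

Lemma negligible_coord0 :
  kappa0.-negligible ([set u | u ord0 ord0 = 0] : set (borelE R d)).
Proof.
have e0 : delta_mx ord0 ord0 != 0 :> 'rV[R]_d.+1.
  by apply/eqP => /matrixP/(_ ord0 ord0)/eqP; rewrite !mxE eqxx oner_eq0.
by apply: negligibleS (negligible_hyperplane e0) => u /=; rewrite coord_dot.
Qed.

Lemma measurable_dot_rep b :
  measurable ([set A | dot b (rep A) = 0] : set (hypersphere_space R d)).
Proof.
have : measurable_fun setT (fun A : hypersphere_space R d => dot b (rep A)).
  by apply: measurable_sum => i; apply: measurable_funM => //; exact: measurable_rep.
by move=> /(_ measurableT _ (measurable_set1 0)); rewrite setTI.
Qed.

Lemma measurable_perp_preimage (B : set (hypersphere_space R d)) :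
  measurable B ->
  measurable ((@perp R d : borelE R d -> hypersphere_space R d) @^-1` B).
Proof.
move=> mB; rewrite -[X in measurable X]setTI; move: B mB.
apply: smallest_sub => //; apply: sigma_algebra_image.
exact: sigma_algebra_measurable.
Qed.

(** After composition with [perp], the product is [dot b u] divided by the first coordinate of [u];
    it vanishes only on two null hyperplanes. *)
Lemma directional_dot_rep b : b != 0 ->
  directional_distribution kappa0 [set A | dot b (rep A) = 0] = 0%E.
Proof.
move=> b0; rewrite /directional_distribution /pushforward.
apply: (measure_negligible (mu := kappa0)).
  by apply: measurable_perp_preimage; exact: measurable_dot_rep.
apply: negligibleS (negligibleU negligible_coord0 (negligible_hyperplane b0)).
move=> u /=; rewrite rep_perp dotZr => /eqP; rewrite mulf_eq0 invr_eq0.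
by move=> /orP[/eqP|/eqP]; [left|right].
Qed.

Lemma directional_chartC :
  directional_distribution kappa0 (~` chart) = 0%E.
Proof.
rewrite /directional_distribution /pushforward.
apply: (measure_negligible (mu := kappa0)).
  by apply: measurable_perp_preimage; apply: measurableC; exact: measurable_chart.
apply: negligibleS negligible_coord0 => u /= uc.
by apply/eqP/negPn/negP => u0; apply: uc; exists u.
Qed.

End Representative.

(** * Frames and their cofactors *)

Section Frame.
Variables (R : realType) (d n : nat).
Implicit Types (s : seq 'I_n) (v : 'I_n -> 'rV[R]_d.+1).

(* The vectors indexed by [s], completed to a square matrix by the last vectors
   of the canonical basis. *)
Definition frame s v : 'M[R]_d.+1 :=
  \matrix_(j, k) if nth None [seq Some i | i <- s] j is Some i
                 then v i ord0 k else (j == k)%:R.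

(** Appending [a] changes only row [j], which this cofactor deletes. *)
Lemma cofactor_frame_rcons s v a (j k : 'I_d.+1) : size s = j ->
  cofactor (frame (rcons s a) v) j k = cofactor (frame s v) j k.
Proof.
move=> sj; rewrite /cofactor; congr (_ * \det _).
apply/matrixP => p q; rewrite !mxE map_rcons nth_rcons size_map sj.
case: ltngtP => //.
  by move=> h; rewrite (nth_default _ (_ : size _ <= _)%N)// size_map sj ltnW.
by move=> h; have /eqP[] := neq_lift j p; exact/val_inj/esym.
Qed.

Lemma det_frame_rcons s v a (j : 'I_d.+1) : size s = j ->
  \det (frame (rcons s a) v) = dot (\row_k cofactor (frame s v) j k) (v a).
Proof.
move=> sj; rewrite (expand_det_row _ j) /dot; apply: eq_bigr => k _.
rewrite cofactor_frame_rcons// !mxE map_rcons nth_rcons size_map sj ltnn eqxx.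
by rewrite mulrC.
Qed.

(** Row [j] is still a basis vector, so the expansion along it has one term. A nonzero determinant
    thus makes the cofactor vector nonzero. *)
Lemma det_frame s v (j : 'I_d.+1) : (size s <= j)%N ->
  \det (frame s v) = cofactor (frame s v) j j.
Proof.
move=> sj; rewrite (expand_det_row _ j) (bigD1 j)//= big1 ?addr0 => [|k kj].
  by rewrite mxE nth_default ?size_map// eqxx mul1r.
by rewrite mxE nth_default ?size_map// eq_sym (negbTE kj) mul0r.
Qed.

Lemma frame_general_position v :
  (forall s, uniq s -> (size s <= d.+1)%N -> \det (frame s v) != 0) ->
  general_position v.
Proof.
move=> h Z c Zd; set s := enum Z.
have sZ : size s = #|Z| by rewrite -cardE.
have Mu : frame s v \in unitmx.
  by rewrite unitmxE unitfE h ?enum_uniq ?sZ.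
(* The values [c] go to the rows of the given vectors, 0 to the rows of the added basis vectors. *)
pose c' : 'cV[R]_d.+1 :=
  \col_j if nth None [seq Some i | i <- s] j is Some i then c i else 0.
exists (invmx (frame s v) *m c')^T => i iZ.
have iS : (index i s < size s)%N by rewrite index_mem mem_enum.
have id1 : (index i s < d.+1)%N by rewrite (leq_trans iS)// sZ.
have ni : nth None [seq Some i | i <- s] (index i s) = Some i.
  by rewrite (nth_map i)// nth_index// mem_enum.
have := mulKVmx Mu c' => /matrixP/(_ (Ordinal id1) ord0).
rewrite mxE [RHS]mxE /= ni => <-; apply: eq_bigr => k _.
by rewrite !mxE /= ni.
Qed.

End Frame.

(** * The null event outside which the representatives are in general position *)

Section AlmostSure.
Context {disp : measure_display} {Omega : measurableType disp} {R : realType}.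
Variables (P : probability Omega R) (d n : nat).
Variable kappa0 : probability (borelE R d) R.
Hypothesis kappa0_even : even_sphere_distribution kappa0.
Hypothesis kappa0_nd : nondegenerate_distribution kappa0.
Variable S : 'I_n -> {RV P >-> hypersphere_space R d}.
Hypothesis S_iid : iid_great_hyperspheres kappa0 S.

Let v (w : Omega) (i : 'I_n) := rep (S i w).

Lemma probability_directional i (B : set (hypersphere_space R d)) :
  measurable B -> directional_distribution kappa0 B = 0%E ->
  P (S i @^-1` B) = 0%E.
Proof. by move=> mB <-; rewrite -(S_iid.2 i). Qed.

Lemma measurable_cofactor_frame disp' (T : measurableType disp') s
    (V : T -> 'I_n -> 'rV[R]_d.+1) (j k : 'I_d.+1) :
  (forall i q, i \in s -> measurable_fun setT (fun w => V w i ord0 q)) ->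
  measurable_fun setT (fun w => cofactor (frame s (V w)) j k).
Proof.
move=> mV; apply: measurable_funM => //; apply: measurable_det => p q.
under eq_fun do rewrite !mxE.
case: (ltnP (lift j p) (size s)) => [ps|ps]; last first.
  by rewrite nth_default ?size_map//; exact: measurable_cst.
have [i is_ ->] : exists2 i, i \in s & nth None [seq Some i | i <- s] (lift j p) = Some i.
  have : nth None [seq Some i | i <- s] (lift j p) \in [seq Some i | i <- s].
    by rewrite mem_nth// size_map.
  by move=> /mapP.
exact: mV.
Qed.

Lemma negligible_det_frame s : uniq s -> (size s <= d.+1)%N ->
  P.-negligible [set w | \det (frame s (v w)) = 0].
Proof.
elim/last_ind: s => [_ _|s a IH].
  rewrite (_ : [set w | _] = set0); first exact: negligible_set0.
  rewrite -subset0 => w /=; have -> : frame [::] (v w) = 1%:M.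
    by apply/matrixP => j k; rewrite !mxE nth_nil.
  by rewrite det1 => /eqP; rewrite oner_eq0.
rewrite rcons_uniq size_rcons => /andP[aS uS] sd.
have {IH} IH := IH uS (ltnW sd).
pose j := Ordinal sd.
(* The cofactor vector of the row that [a] fills; it uses only the vectors indexed by [s], so it is
   measurable for the other variables, as [a] is not in [s]. *)
pose N w : 'rV[R]_d.+1 := \row_k cofactor (frame s (v w)) j k.
pose T1 := g_sigma_algebraType (others S a).
(* A nonzero coordinate [j] of [N] makes every section null: it is empty, or consists of
   hyperspheres whose representative lies in a fixed hyperplane. *)
pose D : set (T1 * hypersphere_space R d) :=
  [set p | N p.1 ord0 j <> 0 /\ dot (N p.1) (rep p.2) = 0].
have mN k : measurable_fun setT ((fun w => N w ord0 k) : T1 -> R).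
  have -> : (fun w => N w ord0 k) = (fun w => cofactor (frame s (v w)) j k).
    by apply/funext => w; rewrite mxE.
  apply: measurable_cofactor_frame => i q iS.
  apply: (measurableT_comp (measurable_rep q)); apply: measurable_fun_others.
  by apply: contraNneq aS => <-.
have mD : measurable D.
  apply: measurableI.
    have : measurable_fun setT (fun p : T1 * hypersphere_space R d => N p.1 ord0 j).
      exact: (measurableT_comp (mN j) measurable_fst).
    by move=> /(_ measurableT _ (measurableC (measurable_set1 0))); rewrite setTI.
  have : measurable_fun setT (fun p : T1 * hypersphere_space R d => dot (N p.1) (rep p.2)).
    apply: measurable_sum => k; apply: measurable_funM.
      exact: (measurableT_comp (mN k) measurable_fst).
    exact: (measurableT_comp (measurable_rep k) measurable_snd).
  by move=> /(_ measurableT _ (measurable_set1 0)); rewrite setTI.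
have ND : P.-negligible [set w | D (othersRV S a w, S a w)].
  apply: independent_negligible => //.
    by move=> A B mA mB; apply: independent_others => //; exact: S_iid.1.
  move=> w; have [Nw|Nw] := eqVneq (N w ord0 j) 0.
    rewrite (_ : _ @^-1` _ = set0) ?measure0//.
    by rewrite -subset0 => x; rewrite /= /xsection /= inE => -[].
  rewrite (_ : xsection D w = [set A | dot (N w) (rep A) = 0]).
    apply: probability_directional; first exact: measurable_dot_rep.
    apply: directional_dot_rep => //.
    by apply: contra_neq Nw => ->; rewrite mxE.
  apply/seteqP; split => A; rewrite /xsection /= inE; first by case.
  by move=> h; split => //; exact/eqP.
apply: negligibleS (negligibleU IH ND) => w /=.
rewrite (@det_frame_rcons _ _ _ _ _ _ j)// => h.
(* Coordinate [j] is the previous determinant, so its vanishing is the event of the induction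
   hypothesis. *)
have [N0|N0] := eqVneq (N w ord0 j) 0.
  by left; rewrite (@det_frame _ _ _ _ _ j)//; move: N0; rewrite mxE.
by right; split => //; exact/eqP.
Qed.

Lemma negligible_bigcup_count (T : countType) (F : T -> set Omega) :
  (forall i, P.-negligible (F i)) -> P.-negligible (\bigcup_i F i).
Proof.
move=> NF; pose G o := if o is Some i then F i else set0.
have NG o : P.-negligible (G o) by case: o => [i|]; [exact: NF|exact: negligible_set0].
apply: negligibleS (negligible_bigcup (fun m => NG (choice.unpickle m))) => w [i _ Fw].
by exists (choice.pickle i) => //; rewrite choice.pickleK.
Qed.

(** Index sequences form a countable type, so the vanishing determinants have a null union; so do
    the finitely many events that [S i] leaves the chart. *)
Lemma almost_surely_general_position :
  P.-negligible [set w | ~ (general_position (v w) /\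
    forall i, S i w = perp (v w i) :> set 'rV[R]_d.+1)].
Proof.
pose Q (s : seq 'I_n) := uniq s && (size s <= d.+1)%N.
have N1 : P.-negligible
    (\bigcup_s (if Q s then [set w | \det (frame s (v w)) = 0] else set0)).
  apply: negligible_bigcup_count => s.
  by case: ifP => [/andP[us sd]|_]; [exact: negligible_det_frame|exact: negligible_set0].
have N2 : P.-negligible (\bigcup_i (S i @^-1` (~` @chart R d))).
  apply: negligible_bigcup_count => i.
  exists (S i @^-1` (~` @chart R d)); split => //.
    by apply: measurable_preimage_RV; apply: measurableC; exact: measurable_chart.
  apply: probability_directional; first by apply: measurableC; exact: measurable_chart.
  exact: directional_chartC.
apply: negligibleS (negligibleU N1 N2) => w /= h.
apply: contrapT => /not_orP[h1 h2]; apply: h; split.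
  apply: frame_general_position => s us sd; apply/eqP => s0; apply: h1.
  by exists s => //; rewrite /Q us sd.
by move=> i; apply/esym/chart_perp; apply: contrapT => ci; apply: h2; exists i.
Qed.

End AlmostSure.
Theorem theorem5p2 (R : realType) (d k l n : nat)
    (d_ge1 : (1 <= d)%N) (k_le_d : (k <= d)%N) (l_lt_k : (l < k)%N)
    (n_ge : (d - k <= n)%N)
    (kappa0 : probability (borelE R d) R)
    (kappa0_even : even_sphere_distribution kappa0)
    (kappa0_nondegenerate : nondegenerate_distribution kappa0)
    (disp : measure_display) (Omega : measurableType disp)
    (P : probability Omega R)
    (S : 'I_n -> {RV P >-> hypersphere_space R d})
    (S_iid : iid_great_hyperspheres kappa0 S) :
  typical_face_expectation k S (fun F => (face_number l F)%:R) =
  ((2 ^ (k - l) * 'C(n + k - d, k - l) * cell_number (n + l - d) l)%:R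
     / (cell_number (n + k - d) k)%:R)%:E.
Proof.
have N := almost_surely_general_position kappa0_even kappa0_nondegenerate S_iid.
rewrite /typical_face_expectation; apply: (expectation_negligible_cst _ _ N).
- by move=> w; apply: divr_ge0 => //; apply: sumr_ge0.
- by apply: divr_ge0.
move=> w /= /contrapT[gp SE].
rewrite -(uniform_mean_general_position d_ge1 k_le_d l_lt_k n_ge gp).
by congr (uniform_mean (tess_faces k _) _); apply/funext.
Qed.
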